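(* For every integer $k\geq 1$, as formal power series in $q$ (whose coefficients are Laurent polynomials in $x_1,\ldots,x_{k+1}$), \[ \sum_{m_1=1}^{\infty}\sum_{m_2,\ldots,m_{k+1}=-\infty}^{\infty}\sum_{n=1}^{\infty}D_{k+1}(m_1,m_2,\ldots,m_{k+1};n)\,x_1^{m_1}\cdots x_{k+1}^{m_{k+1}}q^n =\frac{1}{(q;q)_\infty}\sum_{n=1}^{\infty}(-1)^{n-1}q^{n(3n+1)/2+kn}\frac{x_1(1-q^n)}{(1-x_1q^n)\prod_{j=2}^{k+1}(1-x_jq^n)(1-x_j^{-1}q^n)}. \]
   Context: $(q;q)_\infty=\prod_{j\ge1}(1-q^j)$, and on the right-hand side the factors $1/(1-x_1q^n)$ and $1/((1-x_jq^n)(1-x_j^{-1}q^n))$ are expanded as power series in $q$. A partition $\lambda=(\lambda_1,\ldots,\lambda_s)$ has parts $\lambda_1\ge\cdots\ge\lambda_s\ge1$; $\ell(\lambda)=s$ and $|\lambda|$ is its sum. For a positive integer $K$, a $K$-marked Durfee symbol of $n$ is an array $\tau=\begin{pmatrix}\alpha^K,&\ldots,&\alpha^1\\ \beta^K,&\ldots,&\beta^1\end{pmatrix}_D$ consisting of $K$ pairs $(\alpha^j,\beta^j)$ of partitions and a positive integer $D$ such that: (1) $\alpha^j$ is nonempty for $1\le j<K$, while $\alpha^K$ and all $\beta^j$ may be empty; (2) for $2\le j\le K$, $\beta^{j-1}_1\le\alpha^{j-1}_1\le\min\{\alpha^j_s,\beta^j_s\}$, where $\alpha^j_s,\beta^j_s$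 denote smallest parts (minimum over the nonempty ones) and $\beta^{j-1}_1$ the largest part of $\beta^{j-1}$ (vacuous if empty); (3) $\alpha^K_1,\beta^K_1\le D$; (4) $\sum_{j=1}^K(|\alpha^j|+|\beta^j|)+D^2=n$. The $j$-th rank is $\rho_j(\tau)=\ell(\alpha^j)-\ell(\beta^j)-1$ for $1\le j<K$ and $\rho_K(\tau)=\ell(\alpha^K)-\ell(\beta^K)$. $D_K(m_1,\ldots,m_K;n)$ denotes the number of $K$-marked Durfee symbols $\tau$ of $n$ with $\rho_j(\tau)=m_j$ for all $1\le j\le K$.
   Formalization: When α^K and β^K are both empty, the minimum in condition (2) is read as D, so all parts of the symbol are at most D; read as vacuous, the identity fails (k=1, α^1=(2,1), D=1, coefficient of x_1q^4). *)

(* Defs.v *)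
From HB Require Import structures.
From mathcomp Require Import all_boot all_order all_algebra.
From mathcomp Require Import finmap.
From mathcomp Require Import boolp classical_sets functions cardinality fsbigop.
From mathcomp Require Import mpoly.

Set Implicit Arguments.
Unset Strict Implicit.
Unset Printing Implicit Defensive.

Import Order.TTheory GRing.Theory Num.Theory.

Local Open Scope ring_scope.

Record fps (R : Type) := FPS { fps_coef : nat -> R }.

HB.instance Definition _ (R : Type) := gen_eqMixin (fps R).
HB.instance Definition _ (R : Type) := gen_choiceMixin (fps R).

Lemma fpsP (R : Type) (f g : fps R) :
  (forall N, fps_coef f N = fps_coef g N) -> f = g.
Proof. by case: f => f; case: g => g /= fg; congr FPS; apply: funext. Qed.

Section FpsRing.
Context {R : comNzRingType}.
Implicit Types f g h : fps R.

Definition fps_zero : fps R := FPS (fun=> 0).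
Definition fps_opp f : fps R := FPS (fun N => - fps_coef f N).
Definition fps_add f g : fps R := FPS (fun N => fps_coef f N + fps_coef g N).

Fact fps_addA : associative fps_add.
Proof. by move=> f g h; apply: fpsP => N /=; rewrite addrA. Qed.
Fact fps_addC : commutative fps_add.
Proof. by move=> f g; apply: fpsP => N /=; rewrite addrC. Qed.
Fact fps_add0 : left_id fps_zero fps_add.
Proof. by move=> f; apply: fpsP => N /=; rewrite add0r. Qed.
Fact fps_addN : left_inverse fps_zero fps_opp fps_add.
Proof. by move=> f; apply: fpsP => N /=; rewrite addNr. Qed.

HB.instance Definition _ :=
  GRing.isZmodule.Build (fps R) fps_addA fps_addC fps_add0 fps_addN.

Definition fpsC (c : R) : fps R := FPS (fun N => if N == 0%N then c else 0).
Definition fpsq : fps R := FPS (fun N => if N == 1%N then 1 else 0).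
Definition fps_mul f g : fps R :=
  FPS (fun N => \sum_(i < N.+1) fps_coef f i * fps_coef g (N - i)).

Fact fps_mulC : commutative fps_mul.
Proof.
move=> f g; apply: fpsP => N /=; rewrite (reindex_inj rev_ord_inj) /=.
by apply: eq_bigr => i _; rewrite subSS mulrC subKn // -ltnS.
Qed.

Fact fps_mulA : associative fps_mul.
Proof.
move=> p q r; apply: fpsP => i /=.
pose c3 j k := fps_coef p j * (fps_coef q (i - j - k)%N * fps_coef r k).
transitivity (\sum_(j < i.+1) \sum_(k < i.+1 | (k <= i - j)%N) c3 j k).
  apply: eq_bigr => /= j _; rewrite (reindex_inj rev_ord_inj) /= big_distrr /=.
  rewrite (big_ord_narrow_leq (leq_subr _ _)) /=.
  by apply: eq_bigr => k _; rewrite /c3 subSS subKn // -ltnS.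
rewrite (exchange_big_dep predT) //= (reindex_inj rev_ord_inj) /=.
apply: eq_bigr => k _; rewrite subSS.
transitivity (\sum_(j < i.+1 | (j <= k)%N) c3 j (i - k)%N).
  apply: eq_bigl => j.
  by rewrite leq_sub2lE // -ltnS.
have lek : (k <= i)%N by rewrite -ltnS.
rewrite (big_ord_narrow_leq lek) /=.
rewrite big_distrl /=.
apply: eq_bigr => j _; rewrite /c3 mulrA; congr (_ * fps_coef q _ * _).
by rewrite subnAC subKn // -ltnS.
Qed.

Fact fps_mul1 : left_id (fpsC 1) fps_mul.
Proof.
move=> f; apply: fpsP => N /=; rewrite big_ord_recl /= mul1r subn0.
by rewrite big1 ?addr0 // => i _; rewrite mul0r.
Qed.

Fact fps_mulD : left_distributive fps_mul fps_add.
Proof.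
move=> f g h; apply: fpsP => N /=; rewrite -big_split /=.
by apply: eq_bigr => i _; rewrite mulrDl.
Qed.

Fact fps_1neq0 : fpsC 1 != 0.
Proof.
by apply/eqP => /(congr1 (fun f => fps_coef f 0))/eqP /=; rewrite oner_eq0.
Qed.

HB.instance Definition _ := GRing.Zmodule_isComNzRing.Build (fps R)
  fps_mulA fps_mulC fps_mul1 fps_mulD fps_1neq0.

Definition fps_unit : pred (fps R) := fun f => `[< exists g, g * f = 1 >].
Definition fps_inv f : fps R :=
  if pselect (exists g, g * f = 1) is left ex then sval (cid ex) else f.

Fact fps_mulV : {in fps_unit, left_inverse 1 fps_inv *%R}.
Proof.
move=> f /asboolP ex; rewrite /fps_inv.
by case: pselect => // ex'; case: cid.
Qed.
Fact fps_unitP f g : g * f = 1 -> fps_unit f.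
Proof. by move=> gf; apply/asboolP; exists g. Qed.
Fact fps_inv_out : {in [predC fps_unit], fps_inv =1 id}.
Proof.
move=> f /negP nf; rewrite /fps_inv; case: pselect => // ex.
by case: nf; apply/asboolP.
Qed.

HB.instance Definition _ := GRing.ComNzRing_hasMulInverse.Build (fps R)
  fps_mulV fps_unitP fps_inv_out.

(* Denominators such as 1 - c q^n (n > 0) and (q;q)_oo have constant coefficient
   1, so for them [_^-1] is the actual inverse, i.e. the expansion in q. *)
Lemma fps_unit1 f : fps_coef f 0 = 1 -> f \is a GRing.unit.
Proof.
move=> f0; pose h := 1 - f.
have h0 : fps_coef h 0 = 0 by rewrite /= f0 subrr.
have coefN1 g1 g2 N : fps_coef (g1 - g2) N = fps_coef g1 N - fps_coef g2 N by [].
have hX n i : (i < n)%N -> fps_coef (h ^+ n) i = 0.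
  elim: n i => // n IHn i lt_in; rewrite exprS; apply: big1 => j _.
  have [->|j0] := eqVneq (nat_of_ord j) 0%N; first by rewrite h0 mul0r.
  have := ltn_ord j; rewrite ltnS => le_ji.
  rewrite IHn ?mulr0 // -ltnS (leq_trans _ lt_in) // ltnS -subn_gt0 subKn //.
  by rewrite lt0n.
pose G M := \sum_(i < M) h ^+ i.
have GS i N : (i <= N)%N -> fps_coef (G N.+1) i = fps_coef (G i.+1) i.
  elim: N => [|N IHN]; first by rewrite leqn0 => /eqP->.
  rewrite leq_eqVlt => /orP[/eqP-> //|le_iN].
  have -> : G N.+2 = G N.+1 + h ^+ N.+1 by rewrite /G big_ord_recr.
  by rewrite -IHN //= -[RHS]addr0 -[X in _ = _ + X](hX N.+1 i).
apply/asboolP; exists (FPS (fun N => fps_coef (G N.+1) N)).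
apply: fpsP => N.
have -> : f = 1 - h by rewrite /h opprB addrC subrK.
transitivity (fps_coef (G N.+1 * (1 - h)) N).
  apply: eq_bigr => i _; congr (_ * _); rewrite [LHS]/= [RHS]GS //.
  by rewrite -ltnS.
by rewrite mulrC -[1 - h]opprB mulNr -subrX1 opprB coefN1 hX // subr0.
Qed.

Lemma fps_coef_sum (I : Type) (r : seq I) (P : pred I) (F : I -> fps R) N :
  fps_coef (\sum_(i <- r | P i) F i) N = \sum_(i <- r | P i) fps_coef (F i) N.
Proof. exact: (big_morph (fun f => fps_coef f N)). Qed.

(* Sum of a family in which, for every N, only finitely many members have a
   nonzero coefficient at q^N (the coefficientwise sum is 0 otherwise). *)
Definition fps_sum (I : choiceType) (A : set I) (F : I -> fps R) : fps R :=
  FPS (fun N => \sum_(i \in A) fps_coef (F i) N).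

(* (q;q)_oo; the factors 1 - q^j with j > N do not affect the coefficient of
   q^N, see [fps_coef_qqinf]. *)
Definition qqinf : fps R :=
  FPS (fun N => fps_coef (\prod_(1 <= j < N.+1) (1 - fpsq ^+ j)) N).

Lemma fps_coef_qqinf N M : (N <= M)%N ->
  fps_coef (\prod_(1 <= j < M.+1) (1 - fpsq ^+ j)) N = fps_coef qqinf N.
Proof.
have qM f i : fps_coef (fpsq * f) i = if i is i'.+1 then fps_coef f i' else 0.
  rewrite /=; case: i => [|i]; first by rewrite big_ord1 /= mul0r.
  rewrite big_ord_recl big_ord_recl /= mul0r add0r mul1r subSS subn0.
  by rewrite big1 ?addr0 // => j _; rewrite mul0r.
have qXM n f i : (i < n)%N -> fps_coef (fpsq ^+ n * f) i = 0.
  elim: n i => // n IHn [|i] lt_in; rewrite exprS -mulrA qM //.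
  exact: IHn.
elim: M => [|M IHM]; first by rewrite leqn0 => /eqP->.
rewrite leq_eqVlt => /orP[/eqP-> //|leNM].
have -> : \prod_(1 <= j < M.+2) (1 - fpsq ^+ j) =
    (1 - fpsq ^+ M.+1) * \prod_(1 <= j < M.+1) (1 - fpsq ^+ j) :> fps R.
  by rewrite big_nat_recr //= mulrC.
have coefB f g : fps_coef (f - g) N = fps_coef f N - fps_coef g N by [].
by rewrite mulrBl mul1r coefB qXM // subr0 IHM.
Qed.

End FpsRing.

Arguments fpsq {R}.
Arguments qqinf {R}.

Notation "\fpsum_ ( i 'in' A ) F" := (fps_sum A (fun i => F))
  (at level 41, F at level 41, i, A at level 50,
   format "'[' \fpsum_ ( i  'in'  A ) '/  '  F ']'") : ring_scope.

(* The Laurent polynomial ring in x_1, ..., x_n is the subring of this field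
   generated by the variables and their inverses; [lvar i] is x_(i+1). *)
Definition laurent_frac (n : nat) := {fraction {mpoly int[n]}}.
HB.instance Definition _ n := GRing.Field.on (laurent_frac n).

Definition lvar (n : nat) (i : 'I_n) : laurent_frac n :=
  tofrac ('X_i : {mpoly int[n]}).

Definition is_partition (s : seq nat) : bool := sorted geq s && (0%N \notin s).
Definition largest (s : seq nat) : nat := head 0%N s.
Definition smallest (s : seq nat) : nat := last 0%N s.

(* The pair (alpha^j, beta^j) sits at the ordinal of value j - 1. *)
Record durfee_array (K : nat) := DurfeeArray {
  alpha : {ffun 'I_K -> seq nat};
  beta : {ffun 'I_K -> seq nat};
  side : nat }.

HB.instance Definition _ (K : nat) := gen_eqMixin (durfee_array K).
HB.instance Definition _ (K : nat) := gen_choiceMixin (durfee_array K).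

(* All parts are at most D: for j < K this follows from the chain of
   inequalities and the bound on the last pair, except when alpha^K and beta^K
   are both empty; the minimum of their smallest parts is then read as D. *)
Definition marked_durfee (K n : nat) (tau : durfee_array K) : Prop :=
  let: DurfeeArray a b D := tau in
  [/\ (0 < D)%N /\ (forall j, is_partition (a j) /\ is_partition (b j)),
      forall j : 'I_K, (j.+1 < K)%N -> a j != [::],
      forall i j : 'I_K, j = i.+1 :> nat ->
        [/\ (largest (b i) <= largest (a i))%N,
            a j != [::] -> (largest (a i) <= smallest (a j))%N &
            b j != [::] -> (largest (a i) <= smallest (b j))%N],
      forall j, (largest (a j) <= D)%N /\ (largest (b j) <= D)%N &
      (\sum_j (sumn (a j) + sumn (b j)) + D ^ 2)%N = n].

Definition durfee_rank (K : nat) (tau : durfee_array K) (j : 'I_K) : int :=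
  (size (alpha tau j))%:Z - (size (beta tau j))%:Z - (j.+1 < K)%N%:Z.

Definition durfee_set (K : nat) (m : {ffun 'I_K -> int}) (n : nat) :
    set (durfee_array K) :=
  [set tau | marked_durfee n tau /\ forall j, durfee_rank tau j = m j]%classic.

Definition durfee_count (K : nat) (m : {ffun 'I_K -> int}) (n : nat) : nat :=
  #|` fset_set (durfee_set m n)|%fset.

Lemma marked_durfee_finite (K n : nat) :
  finite_set [set tau : durfee_array K | marked_durfee n tau]%classic.
Proof.
pose B := {ffun 'I_K -> n.-bseq 'I_n.+1}.
pose v (f : B) := [ffun i => map (@nat_of_ord _) (f i)].
pose F (t : B * B * 'I_n.+1) := DurfeeArray (v t.1.1) (v t.1.2) t.2.
apply: (@sub_finite_set _ _ (F @` setT)%classic); last first.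
  exact/finite_image/finite_finset.
have bnd s : is_partition s -> (sumn s <= n)%N ->
    {t : n.-bseq 'I_n.+1 | map (@nat_of_ord _) t = s}.
  move=> /andP[_ s0] sn.
  have all_le : all (leq^~ n) s.
    elim: s sn {s0} => //= x s IHs le_n; rewrite (leq_trans (leq_addr _ _) le_n).
    exact: IHs (leq_trans (leq_addl _ _) le_n).
  have size_le : (size s <= n)%N.
    apply: leq_trans sn; elim: s s0 {all_le} => //= x s IHs.
    rewrite inE negb_or eq_sym -lt0n => /andP[x0 /IHs sz].
    by rewrite -add1n leq_add.
  have sz : (size [seq @inord n i | i <- s] <= n)%N by rewrite size_map.
  exists (Bseq sz) => /=; rewrite -map_comp -[RHS]map_id.
  by apply/eq_in_map => i /(allP all_le) /= le_i; rewrite inordK.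
have sum_le (a b : {ffun 'I_K -> seq nat}) j :
    (sumn (a j) + sumn (b j) <= \sum_i (sumn (a i) + sumn (b i)))%N.
  by rewrite (bigD1 j) //= leq_addr.
case=> a b D [[_ part] _ _ _ sumE].
have le_a j : (sumn (a j) <= n)%N.
  rewrite -sumE; apply: leq_trans (leq_addr _ _).
  exact: leq_trans (leq_addr _ _) (sum_le a b j).
have le_b j : (sumn (b j) <= n)%N.
  rewrite -sumE; apply: leq_trans (leq_addr _ _).
  exact: leq_trans (leq_addl _ _) (sum_le a b j).
have le_D : (D < n.+1)%N.
  rewrite ltnS -sumE; apply: leq_trans (leq_addl _ _).
  by case: (D) => // d; rewrite -[X in (X <= _)%N]expn1 leq_pexp2l.
exists ([ffun j => sval (bnd _ (part j).1 (le_a j))],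
        [ffun j => sval (bnd _ (part j).2 (le_b j))], Ordinal le_D) => //.
by rewrite /F /=; congr DurfeeArray; apply/ffunP => j;
  rewrite !ffunE; case: bnd.
Qed.

(* [fset_set] of an infinite set is empty; this rules out that case. *)
Lemma durfee_set_finite (K : nat) (m : {ffun 'I_K -> int}) (n : nat) :
  finite_set (durfee_set m n).
Proof. by apply: sub_finite_set (marked_durfee_finite K n) => tau []. Qed.

(* The coefficient of each q^n in the rank generating function is a finite sum,
   hence a Laurent polynomial. *)
Lemma durfee_count_finite (K n : nat) :
  finite_set [set m : {ffun 'I_K -> int} | durfee_count m n != 0%N]%classic.
Proof.
apply: sub_finite_set (finite_image
  (fun tau => [ffun j => durfee_rank tau j]) (marked_durfee_finite K n)) => m.
rewrite /= /durfee_count cardfs_eq0 => /fset0Pn[tau].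
rewrite in_fset_set; last exact: durfee_set_finite.
rewrite inE => -[tau_n rk]; exists tau => //.
by apply/ffunP => j; rewrite ffunE.
Qed.

(* Main.v *)
(* Adjoining the part D to alpha^K makes all K = k+1 pairs alike: with L_j the
   largest part of alpha^j (so L_K = D) and L_0 = 1, the remaining parts of
   alpha^j and beta^j range freely over [L_{j-1}, L_j].  With
   f_i(x) = (1 - x q^i) (1 - q^i/x), the pairs after the first contribute
   prod_{L_{j-1} <= i <= L_j} 1/f_i(x_j).  The first pair, restricted to positive
   rank, is handled through the partial fractions
   1/(f_1 ... f_D) = sum_i c_{D,i}/f_i,  where
   1/f_i = (1 - q^{2i})^{-1} sum_m x^m q^{i|m|}.
   Since sum_{i <= L <= D} q^L c_{L,i} prod_{L <= j <= D} 1/f_j = q^i c_{D,i}/f_i,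
   every further pair merely multiplies the i-th term by q^i/f_i(x_j).  It remains
   to sum over D, which is the Durfee rectangle identity
   sum_D q^{D^2}/((q)_{D+i} (q)_{D-i}) = q^{i^2}/(q)_oo. *)
Require Import Defs.
From mathcomp Require Import all_boot all_order all_algebra.
From mathcomp Require Import ring zify.
From mathcomp Require Import finmap.
From mathcomp Require Import boolp classical_sets cardinality fsbigop.
From mathcomp Require Import mpoly.

Set Implicit Arguments.
Unset Strict Implicit.
Unset Printing Implicit Defensive.

Import Order.TTheory GRing.Theory Num.Theory.

Local Open Scope ring_scope.

(** * Partial fractions *)

Section PartialFractions.
Variables (S : comUnitRingType) (q : S).
Hypothesis unit_q : forall n, (0 < n)%N -> 1 - q ^+ n \is a GRing.unit.

Definition qpoch n : S := \prod_(1 <= j < n.+1) (1 - q ^+ j).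

Lemma qpoch0 : qpoch 0 = 1.
Proof. by rewrite /qpoch big_geq. Qed.

Lemma qpochS n : qpoch n.+1 = qpoch n * (1 - q ^+ n.+1).
Proof. by rewrite /qpoch big_nat_recr. Qed.

Lemma qpoch_unit n : qpoch n \is a GRing.unit.
Proof.
elim: n => [|n IHn]; first by rewrite qpoch0 unitr1.
by rewrite qpochS unitrM IHn unit_q.
Qed.

Lemma qpochVS n : (qpoch n)^-1 = (qpoch n.+1)^-1 * (1 - q ^+ n.+1).
Proof. by rewrite qpochS invrM ?qpoch_unit ?unit_q // mulrAC mulVr ?unit_q // mul1r. Qed.

(* The coefficients of the partial fractions 1/(f_1 ... f_D) =
   sum_i residue D i / f_i, with f_i = (1 - x q^i) (1 - x^-1 q^i). *)
Definition residue D i : S :=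
  (-1) ^+ i.+1 * q ^+ 'C(i, 2) * (1 - q ^+ i) * (1 - q ^+ (2 * i))
  * ((qpoch (D + i))^-1 * (qpoch (D - i))^-1).

(** The extra factor is f_(D+1) evaluated at the zeros x = q^i and x = q^(-i) of f_i: the
    coefficient at 1/f_i is divided by this value when f_(D+1) joins the product. *)
Lemma residueS D i : (i <= D)%N ->
  residue D i = residue D.+1 i * ((1 - q ^+ (D.+1 + i)) * (1 - q ^+ (D.+1 - i))).
Proof.
move=> le_iD; rewrite /residue subSn // addSn (qpochVS (D + i)) (qpochVS (D - i)).
by rewrite -!mulrA; congr (_ * (_ * (_ * (_ * (_ * _))))); rewrite mulrCA.
Qed.

(* Multiplied by 1 - q^(D-1), the sum in [residue_sum] telescopes. *)
Lemma residue_sum_partial D n : (0 < D)%N -> (n <= D)%N ->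
  (1 - q ^+ D.-1) * (\sum_(1 <= i < n.+1) residue D i * q ^+ (D - i)) =
  (-1) ^+ n.+1 * q ^+ (D.-1 + 'C(n, 2)) * (1 - q ^+ n) * (1 - q ^+ n.+1)
  * (1 - q ^+ (D - n)) * ((qpoch (D + n))^-1 * (qpoch (D - n))^-1).
Proof.
move=> D0; elim: n => [|n IHn] le_nD.
  by rewrite big_geq // expr0 subrr !(mulr0, mul0r).
rewrite big_nat_recr //= mulrDr IHn ?(ltnW le_nD) // /residue.
have [e ->] : exists e, D = (n + e).+1 by exists (D - n.+1)%N; lia.
have -> : ((n + e).+1 - n = e.+1)%N by lia.
have -> : ((n + e).+1 - n.+1 = e)%N by lia.
rewrite addnS (qpochVS (_ + n)) (qpochVS e) /= binS bin1.
set V := (qpoch _)^-1; set U := (qpoch e.+1)^-1.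
have -> : ((2 * n.+1) = n + n + 2)%N by lia.
have -> : ((n + e).+1 + n).+1 = (n + n + e + 2)%N by lia.
rewrite !exprD !exprS !expr0.
set a := q ^+ n; set b := q ^+ e; set Q := q ^+ 'C(n, 2); set s := (-1) ^+ n.
ring.
Qed.

(** For n = D the telescoped sum carries the factor 1 - q^0 = 0, and 1 - q^(D-1) can be cancelled
    once D >= 2. For D = 1 that factor is itself zero, so the single term is computed. *)
Lemma residue_sum D : (0 < D)%N ->
  \sum_(1 <= i < D.+1) residue D i * q ^+ (D - i) = (D == 1%N)%:R.
Proof.
case: D => [|[|D]] // _.
  rewrite big_nat1 /residue subnn qpoch0 invr1.
  have -> : qpoch (1 + 1) = (1 - q ^+ 1) * (1 - q ^+ 2) by rewrite !qpochS qpoch0 mul1r.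
  rewrite (_ : 'C(1, 2) = 0%N) // sqrrN expr1n !expr0 !mulr1 !mul1r mulrV //.
  by rewrite unitrM !unit_q.
have /= := residue_sum_partial (ltn0Sn D.+1) (leqnn _).
rewrite subnn expr0 subrr !(mul0r, mulr0) => /(canRL (mulKr (unit_q (ltn0Sn D)))).
by rewrite mulr0.
Qed.

(** The coefficient of x^m that the partial fractions predict for 1/(f_1 ... f_D); the first summand
    accounts for the empty product at D = 0. *)
Definition rank_gf D (m : int) : S :=
  ((D == 0%N) && (m == 0))%:R +
  \sum_(1 <= i < D.+1) residue D i * q ^+ (i * `|m|)%N / (1 - q ^+ (2 * i)).

(** Coefficients of x^m are compared in f_(D+1) / (f_1 ... f_(D+1)) = 1/(f_1 ... f_D), where f_(D+1)
    = 1 + q^(2(D+1)) - q^(D+1) (x + 1/x). Termwise this is [residueS], except at the kink of |m| at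
    m = 0: there each residue leaves an excess q^(D+1-i), and [residue_sum] adds these up to the
    term of the empty product. *)
Lemma rank_gf_rec D m :
  rank_gf D.+1 m * (1 + q ^+ (2 * D.+1))
    - q ^+ D.+1 * (rank_gf D.+1 (m + 1) + rank_gf D.+1 (m - 1))
  = rank_gf D m.
Proof.
rewrite /rank_gf /= !add0r mulr_suml -big_split mulr_sumr -sumrB /=.
pose t i := residue D.+1 i * ((1 - q ^+ (D.+1 + i)) * (1 - q ^+ (D.+1 - i)))
  * q ^+ (i * `|m|)%N / (1 - q ^+ (2 * i)).
transitivity (\sum_(1 <= i < D.+2)
   (t i + (m == 0)%:R * (residue D.+1 i * q ^+ (D.+1 - i)))).
  apply: eq_big_nat => i /andP[i0 iD]; rewrite /t.
  have u : 1 - q ^+ (2 * i) \is a GRing.unit by apply: unit_q; lia.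
  have [e De] : exists e, D.+1 = (i + e)%N by exists (D.+1 - i)%N; lia.
  have -> : (D.+1 - i)%N = e by lia.
  rewrite De; have Vu := mulVr u.
  (* The excess term is multiplied by V (1 - q^(2i)) = 1, so that V becomes a common factor and a
     polynomial identity remains. *)
  rewrite -[(m == 0)%:R * _]mulr1 -[X in _ = _ + _ * X]Vu {u De}.
  move: Vu; set V := (1 - q ^+ (2 * i))^-1 => Vu; set r := residue _ _.
  transitivity (r * (q ^+ (i * `|m|) * (1 + q ^+ (2 * (i + e)))
      - q ^+ (i + e) * (q ^+ (i * `|(m + 1)%R|) + q ^+ (i * `|(m - 1)%R|))) * V).
    by ring.
  have [->|m0] := eqVneq m 0.
    rewrite add0r sub0r abszN absz0 muln0 muln1.
    have -> : (2 * (i + e) = i + i + e + e)%N by lia.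
    have -> : (2 * i = i + i)%N by lia.
    by rewrite mulr1n expr0 !exprD; ring.
  rewrite mulr0n !mul0r addr0.
  have [p [-> Q]] : exists p, `|m|%N = p.+1 /\
      ((`|(m + 1)%R|%N = p.+2 /\ `|(m - 1)%R|%N = p) \/
       (`|(m + 1)%R|%N = p /\ `|(m - 1)%R|%N = p.+2)).
    exists `|m|.-1%N; lia.
  have -> : (2 * (i + e) = i + i + e + e)%N by lia.
  by case: Q => [[-> ->]|[-> ->]]; rewrite !mulnS !exprD; ring.
rewrite big_split /= -mulr_sumr residue_sum // -natrM mulnb addrC; congr (_ + _).
  by rewrite eqSS andbC.
(* The term i = D + 1 contains 1 - q^0 = 0, which shortens the sum to the range of [rank_gf] at
   D. *)
rewrite big_nat_recr //= [X in _ + X]/t subnn expr0 subrr !(mulr0, mul0r) addr0.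
by apply: eq_big_nat => i /andP[i0 iD]; rewrite /t [in RHS]residueS.
Qed.

(** The factor f_i, with [y] in the place of the inverse of [x]. *)
Definition den (x y : S) i : S := (1 - x * q ^+ i) * (1 - y * q ^+ i).

(** Induction on D. With denominators cleared and [residueS] applied, the step reads q^i (f_(D+1)(x)
    - f_(D+1)(q^i)) = q^(D+1) f_i(x), which holds because each f_j is affine in x + 1/x. *)
Lemma residue_sum_den x y i D : x * y = 1 -> (i <= D)%N ->
  (forall j, (0 < j)%N -> den x y j \is a GRing.unit) -> (0 < i)%N ->
  \sum_(i <= L < D.+1) q ^+ L * residue L i * (\prod_(L <= j < D.+1) (den x y j)^-1)
  = q ^+ i * residue D i / den x y i.
Proof.
move=> xy le_iD ud i0; elim: D le_iD => [|D IHD] le_iD; first by case: i i0 le_iD.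
have [Di|Di] := eqVneq i D.+1; first by rewrite Di !big_nat1.
have {Di}le_iD' : (i <= D)%N by lia.
rewrite big_nat_recr //= big_nat1.
have -> : \sum_(i <= L < D.+1) q ^+ L * residue L i * (\prod_(L <= j < D.+2) (den x y j)^-1)
  = (q ^+ i * residue D i / den x y i) / den x y D.+1.
  rewrite -(IHD le_iD') mulr_suml; apply: eq_big_nat => L /andP[_ LD].
  by rewrite big_nat_recr //= ?mulrA // ltnW.
have ui := ud i i0; have uD := ud D.+1 (ltn0Sn D).
rewrite -mulrDl; apply: (mulIr uD); rewrite mulrVK //.
apply: (mulIr ui); rewrite mulrDl mulrVK // [RHS]mulrAC mulrVK // residueS //.
rewrite /den.
have [e De] : exists e, D.+1 = (i + e)%N by exists (D.+1 - i)%N; lia.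
have -> : (D.+1 - i)%N = e by lia.
rewrite De !exprD.
set r := residue _ _; set a := q ^+ i; set b := q ^+ e.
have E z : (1 - x * z) * (1 - y * z) = 1 - (x + y) * z + z * z.
  by transitivity (1 - (x + y) * z + (x * y) * z * z); [ring | rewrite xy mul1r].
by rewrite !E; ring.
Qed.

(** * Gaussian binomials and the finite Durfee rectangle identity *)

Fixpoint qbinom M s : S :=
  match M, s with
  | _, 0 => 1
  | 0, _.+1 => 0
  | M.+1, s'.+1 => qbinom M s' + q ^+ s * qbinom M s
  end.

Lemma qbinomn0 M : qbinom M 0 = 1.
Proof. by case: M. Qed.

Lemma qbinom_small M s : (M < s)%N -> qbinom M s = 0.
Proof.
elim: M s => [|M IHM] [|s] //= lt_Ms.
by rewrite !IHM ?mulr0 ?addr0 //; lia.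
Qed.

(** Partitions with parts at most M + m are split at the largest rectangle of s rows and s + m
    columns inside the diagram. The proof is an induction on M that trades one unit of M for one of
    m. *)
Lemma durfee_rectangle M m :
  \sum_(0 <= s < M.+1) q ^+ (s * (s + m)) * qbinom M s / qpoch (s + m)
  = (qpoch (M + m))^-1.
Proof.
elim: M m => [|M IHM] m; first by rewrite big_nat1 /= mul1r mul1r.
rewrite addSnnS -IHM big_nat_recl // qbinomn0 mul0n expr0 !mul1r.
(* Pascal's rule splits the term s + 1 into [t1 s] and [t2 s.+1]. Regrouped as [t1 s + t2 s], with
   both over (q;q)_(s+m+1), the two pieces give the term s of the sum for m + 1. *)
pose t1 s := q ^+ (s.+1 * (s.+1 + m)) * qbinom M s / qpoch (s.+1 + m).
pose t2 s := q ^+ (s * (s + m) + s) * qbinom M s / qpoch (s + m).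
transitivity (t2 0 + \sum_(0 <= s < M.+1) (t1 s + t2 s.+1)).
  rewrite /t2 !mul0n expr0 qbinomn0 !mul1r; congr (_ + _); apply: eq_big_nat => s _.
  by rewrite /t1 /t2 /= mulrDr mulrDl exprD !mulrA.
rewrite big_split /= addrCA -(big_nat_recl _ _ t2) //.
rewrite (@big_nat_recr _ _ _ M.+1) //= [t2 M.+1]/t2 (qbinom_small (leqnn M.+1)) mulr0 mul0r addr0.
rewrite -big_split /=; apply: eq_big_nat => s _; rewrite /t1 /t2.
rewrite (qpochVS (s + m)) -addnS addSnnS.
have -> : (s.+1 * (s + m.+1) = s * (s + m.+1) + (s + m.+1))%N by lia.
have -> : (s * (s + m) + s = s * (s + m.+1))%N by lia.
by rewrite exprD; ring.
Qed.

End PartialFractions.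

(** * Summable families of power series *)

Section FpsSums.
Variable R : comNzRingType.
Implicit Types (f g : fps R) (I J K : choiceType).

(** Congruence modulo q^(N+1), which allows infinite sums to be replaced by finite ones. *)
Definition eqm N f g := forall i, (i <= N)%N -> fps_coef f i = fps_coef g i.

Lemma eqm_sym N f g : eqm N f g -> eqm N g f.
Proof. by move=> fg i iN; rewrite fg. Qed.

Lemma eqm_trans N g f h : eqm N f g -> eqm N g h -> eqm N f h.
Proof. by move=> fg gh i iN; rewrite fg ?gh. Qed.

Lemma eqmP f g : (forall N, eqm N f g) -> f = g.
Proof. by move=> fg; apply: fpsP => N; apply: (fg N). Qed.

Lemma eqmD N f f' g g' : eqm N f f' -> eqm N g g' -> eqm N (f + g) (f' + g').
Proof. by move=> ff gg i iN /=; rewrite ff ?gg. Qed.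

Lemma eqmN N f f' : eqm N f f' -> eqm N (- f) (- f').
Proof. by move=> ff i iN /=; rewrite ff. Qed.

Lemma eqmM N f f' g g' : eqm N f f' -> eqm N g g' -> eqm N (f * g) (f' * g').
Proof.
move=> ff gg i iN; apply: eq_bigr => j _; have := ltn_ord j => ji.
by rewrite ff ?gg //; lia.
Qed.

Lemma eqmMl N f g g' : eqm N g g' -> eqm N (f * g) (f * g').
Proof. exact: eqmM. Qed.

Lemma eqmMl0 N f g : eqm N g 0 -> eqm N (f * g) 0.
Proof. by rewrite -[X in _ -> eqm N _ X](mulr0 f); apply: eqmMl. Qed.

Lemma eqm_sum N (I : eqType) (r : seq I) (F G : I -> fps R) :
  (forall i, i \in r -> eqm N (F i) (G i)) ->
  eqm N (\sum_(i <- r) F i) (\sum_(i <- r) G i).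
Proof.
elim: r => [|i r IHr] FG; first by rewrite !big_nil.
rewrite !big_cons; apply: eqmD; first by apply: FG; rewrite mem_head.
by apply: IHr => j jr; apply: FG; rewrite inE jr orbT.
Qed.

Lemma eqm_sum0 N (I : eqType) (r : seq I) (F : I -> fps R) :
  (forall i, i \in r -> eqm N (F i) 0) -> eqm N (\sum_(i <- r) F i) 0.
Proof. by move=> /eqm_sum; rewrite big1_eq. Qed.

Lemma coef_qM f i : fps_coef (fpsq * f) i = if i is i'.+1 then fps_coef f i' else 0.
Proof.
rewrite /=; case: i => [|i]; first by rewrite big_ord1 /= mul0r.
rewrite big_ord_recl big_ord_recl /= mul0r add0r mul1r subSS subn0.
by rewrite big1 ?addr0 // => j _; rewrite mul0r.
Qed.

Lemma coef_qXM n f i :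
  fps_coef (fpsq ^+ n * f) i = if (n <= i)%N then fps_coef f (i - n) else 0.
Proof.
elim: n i => [|n IHn] i; first by rewrite expr0 mul1r subn0.
by rewrite exprS -mulrA coef_qM; case: i => // i; rewrite IHn.
Qed.

Lemma coef_qX n i : fps_coef (fpsq ^+ n : fps R) i = (i == n)%:R.
Proof.
rewrite -[fpsq ^+ n]mulr1 coef_qXM /=.
by case: ltngtP => [ni|//|->]; rewrite ?subnn // subn_eq0 leqNgt ni.
Qed.

Lemma eqm_qXM N n f : (N < n)%N -> eqm N (fpsq ^+ n * f) 0.
Proof. by move=> Nn i iN; rewrite coef_qXM leqNgt (leq_ltn_trans iN Nn). Qed.

Lemma coef_CM c f i : fps_coef (fpsC c * f) i = c * fps_coef f i.
Proof.
rewrite /= big_ord_recl /= subn0 big1 ?addr0 // => j _.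
by rewrite mul0r.
Qed.

Lemma fpsCM c d : fpsC (c * d) = fpsC c * fpsC d :> fps R.
Proof.
by apply: fpsP => i; rewrite coef_CM /=; case: (i == 0%N); rewrite ?mulr0.
Qed.

Lemma fpsC_prod n (c : 'I_n -> R) :
  fpsC (\prod_i c i) = \prod_i fpsC (c i) :> fps R.
Proof. exact: (big_morph (@fpsC R) fpsCM (erefl _)). Qed.

(** One list serves all degrees up to N. It may repeat entries or leave [A], which keeps summability
    easy to prove; [summable_enum] cleans it up. *)
Definition summable I (A : set I) (F : I -> fps R) :=
  forall N, exists r : seq I, forall i, A i -> i \notin r -> eqm N (F i) 0.

Lemma coef_fps_sum I (A : set I) (F : I -> fps R) N :
  fps_coef (fps_sum A F) N = \sum_(i \in A) fps_coef (F i) N.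
Proof. by []. Qed.

Lemma summable_enum I (A : set I) (F : I -> fps R) N : summable A F ->
  exists r : seq I, [/\ uniq r, forall i, i \in r -> A i &
    forall i, A i -> i \notin r -> eqm N (F i) 0].
Proof.
move=> /(_ N)[r rF]; exists [seq i <- undup r | `[< A i >]]; split.
- by rewrite filter_uniq ?undup_uniq.
- by move=> i; rewrite mem_filter => /andP[/asboolP].
- by move=> i Ai; rewrite mem_filter mem_undup asboolT //=; apply: rF.
Qed.

Lemma fps_sum_enum I (A : set I) (F : I -> fps R) N (r : seq I) :
  uniq r -> (forall i, i \in r -> A i) ->
  (forall i, A i -> i \notin r -> eqm N (F i) 0) ->
  eqm N (fps_sum A F) (\sum_(i <- r) F i).
Proof.
move=> ur rA rF n nN; rewrite fps_coef_sum coef_fps_sum (fsbigE r) //.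
  by rewrite [RHS]big_seq [LHS]big_seq_cond; apply: eq_bigl => i;
     have [/rA Ai|//] := boolP (i \in r); rewrite mem_set.
by move=> i Ai ri; rewrite (rF i).
Qed.

Lemma fps_sum_seq I (r : seq I) (A : set I) (F : I -> fps R) :
  uniq r -> (forall i, A i <-> i \in r) -> fps_sum A F = \sum_(i <- r) F i.
Proof.
move=> ur Ar; apply: eqmP => N; apply: fps_sum_enum => // i /Ar //.
by move=> ->.
Qed.

Lemma eq_fps_sum I (A B : set I) (F G : I -> fps R) :
  (forall i, A i <-> B i) -> (forall i, A i -> F i = G i) ->
  fps_sum A F = fps_sum B G.
Proof.
move=> AB FG; have <- : A = B by apply/seteqP; split=> i /AB.
by apply: fpsP => N; apply: eq_fsbigr => i; rewrite inE => /FG ->.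
Qed.

Lemma sub_summable I (A B : set I) (F : I -> fps R) :
  (forall i, A i -> B i) -> summable B F -> summable A F.
Proof. by move=> AB sF N; have [r rF] := sF N; exists r => i /AB; apply: rF. Qed.

Lemma summableMl I (A : set I) (C F : I -> fps R) :
  summable A F -> summable A (fun i => C i * F i).
Proof.
by move=> sF N; have [r rF] := sF N; exists r => i Ai ri; apply/eqmMl0/rF.
Qed.

Lemma fps_sumMl I (A : set I) c (F : I -> fps R) :
  summable A F -> fps_sum A (fun i => c * F i) = c * fps_sum A F.
Proof.
move=> sF; apply: eqmP => N; have [r [ur rA rF]] := summable_enum N sF.
apply: (eqm_trans (g := \sum_(i <- r) c * F i)).
  by apply: fps_sum_enum => // i Ai ri; apply/eqmMl0/rF.
by rewrite -mulr_sumr; apply/eqmMl/eqm_sym/fps_sum_enum.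
Qed.

Lemma summable_prod I J (A : set I) (B : set J) (F : I -> fps R) (G : J -> fps R) :
  summable A F -> summable B G ->
  summable (fun p => A p.1 /\ B p.2) (fun p => F p.1 * G p.2).
Proof.
move=> sF sG N; have [r rF] := sF N; have [s sG'] := sG N.
exists [seq (i, j) | i <- r, j <- s] => -[i j] /= [Ai Bj] ij.
have [ir|/(rF _ Ai)] := boolP (i \in r); last first.
  by rewrite mulrC; apply: eqmMl0.
have [js|/(sG' _ Bj)] := boolP (j \in s); last exact: eqmMl0.
by rewrite allpairs_f in ij.
Qed.

Lemma fps_sum_prod I J (A : set I) (B : set J) (F : I -> fps R) (G : J -> fps R) :
  summable A F -> summable B G ->
  fps_sum (fun p => A p.1 /\ B p.2) (fun p => F p.1 * G p.2) =
  fps_sum A F * fps_sum B G.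
Proof.
move=> sF sG; apply: eqmP => N.
have [r [ur rA rF]] := summable_enum N sF.
have [s [us sB sG']] := summable_enum N sG.
apply: (eqm_trans (g := (\sum_(i <- r) F i) * (\sum_(j <- s) G j))); last first.
  by apply/eqm_sym/eqmM; apply: fps_sum_enum.
rewrite mulr_suml; under eq_bigr do rewrite mulr_sumr.
rewrite -(@big_allpairs _ _ _ _ _ r s (fun p => F p.1 * G p.2)).
apply: fps_sum_enum.
- by apply: allpairs_uniq => // -[? ?] [].
- by move=> p /allpairsP[[i j] /= [/rA Ai /sB Bj ->]].
move=> [i j] /= [Ai Bj] ij.
have [ir|/(rF _ Ai)] := boolP (i \in r); last first.
  by rewrite mulrC; apply: eqmMl0.
have [js|/(sG' _ Bj)] := boolP (j \in s); last exact: eqmMl0.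
by rewrite allpairs_f in ij.
Qed.

Lemma summable_reindex I J (A : set I) (B : set J) (h : I -> J) (g : J -> I)
    (F : J -> fps R) :
  (forall i, A i -> B (h i) /\ g (h i) = i) -> summable B F ->
  summable A (fun i => F (h i)).
Proof.
move=> hA sF N; have [r rF] := sF N; exists [seq g j | j <- r] => i.
move=> /hA[Bi gi] ir; apply: rF => //; apply: contra ir => ir.
by rewrite -gi map_f.
Qed.

Lemma fps_sum_reindex I J (A : set I) (B : set J) (h : I -> J) (g : J -> I)
    (F : J -> fps R) :
  (forall i, A i -> B (h i) /\ g (h i) = i) ->
  (forall j, B j -> A (g j) /\ h (g j) = j) -> 
  fps_sum B F = fps_sum A (fun i => F (h i)).
Proof.
move=> hA gB; apply: fpsP => N; apply: reindex_fsbig; split.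
- by move=> i /hA[].
- move=> i i'; rewrite !inE => /hA[_ gi] /hA[_ gi'] hh.
  by rewrite -gi -gi' hh.
- by move=> j /gB[Agj hgj]; exists (g j).
Qed.

Lemma sum_by_key (I K : eqType) (r : seq I) (ks : seq K) (key : I -> K)
    (F : I -> fps R) : uniq ks -> (forall i, i \in r -> key i \in ks) ->
  \sum_(k <- ks) \sum_(i <- r | key i == k) F i = \sum_(i <- r) F i.
Proof.
move=> uk rk; under eq_bigr do rewrite big_mkcond /=.
rewrite exchange_big /= [LHS]big_seq [RHS]big_seq; apply: eq_bigr => i ir.
rewrite (bigD1_seq (key i)) ?rk //= eqxx big1 ?addr0 // => k.
by rewrite eq_sym => /negPf ->.
Qed.

(** Modulo q^(N+1) both sides reduce to a finite sum over the list [r], grouped by the finitely many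
    keys [ks] that occur in it. *)
Lemma fps_sum_key I K (A : set I) (B : set K) (key : I -> K) (F : I -> fps R) :
  summable A F -> (forall i, A i -> B (key i)) ->
  fps_sum A F = fps_sum B (fun k => fps_sum (fun i => A i /\ key i = k) F).
Proof.
move=> sF keyB; apply: eqmP => N; have [r [ur rA rF]] := summable_enum N sF.
pose ks := undup (map key r).
have key_ks i : i \in r -> key i \in ks.
  by move=> ir; rewrite mem_undup map_f.
apply: eqm_trans (fps_sum_enum ur rA rF) _; apply: eqm_sym.
rewrite -(sum_by_key F (undup_uniq _) key_ks).
have inner k : eqm N (fps_sum (fun i => A i /\ key i = k) F)
    (\sum_(i <- r | key i == k) F i).
  rewrite -big_filter; apply: fps_sum_enum; rewrite ?filter_uniq //.
    by move=> i; rewrite mem_filter => /andP[/eqP -> /rA].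
  move=> i [Ai ik]; rewrite mem_filter ik eqxx /=; exact: rF.
apply: (@eqm_trans _ (\sum_(k <- ks) fps_sum (fun i => A i /\ key i = k) F)).
  apply: fps_sum_enum; first exact: undup_uniq.
    by move=> k; rewrite mem_undup => /mapP[i /rA /keyB Bi ->].
  move=> k _ kks; apply: eqm_trans (inner k) _.
  rewrite big1_seq // => i /andP[/eqP ki ir].
  by rewrite -ki key_ks in kks.
by apply: eqm_sum => k _; apply: inner.
Qed.

Lemma fps_sum_key_nat I (A : set I) (key : I -> nat) (F : I -> fps R) D :
  summable A F -> (forall i, A i -> (1 <= key i <= D)%N) ->
  fps_sum A F = \sum_(1 <= L < D.+1) fps_sum (fun i => A i /\ key i = L) F.
Proof.
move=> sF keyD; rewrite (@fps_sum_key _ _ A [set L | (1 <= L <= D)%N]%classic key) //.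
apply: fps_sum_seq; first exact: iota_uniq.
by move=> L; rewrite mem_index_iota ltnS.
Qed.

Lemma fps_sumID I (A : set I) (B : pred I) (F : I -> fps R) :
  summable A F ->
  fps_sum A F = fps_sum (fun i => A i /\ B i) F + fps_sum (fun i => A i /\ ~~ B i) F.
Proof.
move=> sF; rewrite (@fps_sum_key _ _ A setT B) //.
rewrite (@fps_sum_seq _ [:: true; false]) //; last by case.
rewrite big_cons big_seq1; congr (_ + _); apply: eq_fps_sum => //= i.
by case: (B i); split=> -[].
Qed.

Lemma fps_sum_widen I (A B : set I) (F : I -> fps R) :
  (forall i, A i -> B i) -> (forall i, B i -> ~ A i -> F i = 0) ->
  fps_sum A F = fps_sum B F.
Proof.
move=> AB F0; apply: fpsP => N; apply: fsbig_widen => // i [Bi nAi] /=.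
by rewrite F0.
Qed.

Lemma fps_sum_nat (F : nat -> fps R) N M : (N <= M)%N ->
  (forall n, (N < n)%N -> eqm N (F n) 0) ->
  eqm N (fps_sum [set n | (1 <= n)%N]%classic F) (\sum_(1 <= n < M.+1) F n).
Proof.
move=> NM F0; apply: fps_sum_enum; first exact: iota_uniq.
  by move=> n; rewrite mem_index_iota => /andP[].
move=> n n0; rewrite mem_index_iota n0 /= ltnS -ltnNge => Mn; apply: F0.
exact: leq_ltn_trans Mn.
Qed.

End FpsSums.

(** * Pairs of partitions counted by rank *)

Definition part_in l L (s : seq nat) : bool :=
  sorted geq s && all (fun p => l <= p <= L)%N s.

Lemma part_in_cons l L x s :
  part_in l L (x :: s) = (l <= x <= L)%N && part_in l x s.
Proof.
have geq_trans : transitive geq by move=> a b c /= ab ca; apply: leq_trans ca ab.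
rewrite /part_in /= (path_sortedE geq_trans).
have [/andP[lx xL]|] := boolP (l <= x <= L)%N; last by rewrite andbF.
rewrite /= [all (geq x) s && _]andbC -andbA -all_predI; congr (_ && _).
by apply: eq_all => p /=; lia.
Qed.

Lemma part_in_empty l s : part_in l.+1 l s = (s == [::]).
Proof. by case: s => // x s; rewrite part_in_cons; apply/negbTE; lia. Qed.

Lemma part_in_neq l L s : part_in l L.+1 s ->
  (head 0%N s != L.+1) = part_in l L s.
Proof.
by case: s => // x s; rewrite !part_in_cons => /andP[xL ->] /=; lia.
Qed.

Section PairSums.
Variable R : comUnitRingType.
Implicit Types (x : R) (w : int -> R).
Local Notation q := (fpsq : fps R).

Lemma unit_1BCqX x n : (0 < n)%N -> 1 - fpsC x * q ^+ n \is a GRing.unit.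
Proof.
move=> n0; apply: fps_unit1.
rewrite -[LHS]/(1 - fps_coef (fpsC x * q ^+ n) 0) coef_CM coef_qX.
by case: n n0 => // n _; rewrite mulr0 subr0.
Qed.

Lemma unit_1BqX n : (0 < n)%N -> 1 - q ^+ n \is a GRing.unit.
Proof. by move=> /(unit_1BCqX 1); rewrite mul1r. Qed.

(** Positive entries bound the length of a list by its sum, so only finitely many such lists have
    sum at most N. *)
Lemma summable_qXsumn :
  summable (fun s : seq nat => 0%N \notin s) (fun s => q ^+ sumn s).
Proof.
move=> N.
(* After n rounds, [ext] has listed all words of length at most n over 1, ..., N. *)
pose ext (r : seq (seq nat)) := [::] :: [seq a :: s | a <- iota 1 N, s <- r].
exists (iter N ext [:: [::]]) => s s0.
have [le_sN|Ns] := leqP (sumn s) N; last first.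
  by move=> _; rewrite -[q ^+ _]mulr1; apply: eqm_qXM.
move=> /negP[].
have: (size s <= N)%N.
  apply: leq_trans le_sN; elim: s s0 => //= a s IHs.
  rewrite inE negb_or eq_sym -lt0n => /andP[a0 /IHs].
  by rewrite -add1n; apply: leq_add.
(* The induction varies the bound on the length and the number of rounds; the bound N on the sum,
   hence on the entries, stays fixed. *)
elim: {2 3}N s s0 le_sN => [|n IHn] [|a s] //= as0 sN sn.
rewrite inE /=; move: as0; rewrite inE negb_or eq_sym -lt0n => /andP[a0 s0].
by apply: allpairs_f; [rewrite mem_iota; lia | apply: IHn => //; lia].
Qed.

(** The upper bounds of the two partitions are kept apart so that they can be raised one at a
    time. *)
Definition pair_in l L L' (p : seq nat * seq nat) : bool :=
  part_in l L p.1 && part_in l L' p.2.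

Definition pair_rank (p : seq nat * seq nat) : int :=
  (size p.1)%:Z - (size p.2)%:Z.

(** The weight [w] of the rank will be a power x^m, such a power cut off to m >= 1, or the indicator
    of a single rank. *)
Definition pair_weight w p : fps R :=
  fpsC (w (pair_rank p)) * (q ^+ sumn p.1 * q ^+ sumn p.2).

Definition pair_gf w l L L' := fps_sum (pair_in l L L') (pair_weight w).

Lemma eq_pair_gf w w' l L L' : w =1 w' -> pair_gf w l L L' = pair_gf w' l L L'.
Proof. by move=> /funext ->. Qed.

Lemma part_in_pos l L s : (0 < l)%N -> part_in l L s -> 0%N \notin s.
Proof. by move=> l0 /andP[_ /allP sl]; apply/negP => /sl; lia. Qed.

Lemma summable_pair w l L L' : (0 < l)%N -> summable (pair_in l L L') (pair_weight w).
Proof.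
move=> l0; apply: summableMl; apply: sub_summable (summable_prod summable_qXsumn summable_qXsumn).
by move=> p /andP[/(part_in_pos l0) ? /(part_in_pos l0)].
Qed.

Lemma pair_gf_swap w l L L' : pair_gf w l L L' = pair_gf (fun m => w (- m)) l L' L.
Proof.
rewrite /pair_gf (@fps_sum_reindex _ _ _ (pair_in l L' L) _ (fun p => (p.2, p.1))
  (fun p => (p.2, p.1))).
- apply: eq_fps_sum => // p _; rewrite /pair_weight /pair_rank /=.
  by rewrite opprB [q ^+ _ * _]mulrC.
- by move=> [a b] /andP[pa pb]; rewrite /pair_in /= pa pb.
- by move=> [a b] /andP[pa pb]; rewrite /pair_in /= pa pb.
Qed.

(** Either L + 1 is not a part of the first partition, or one copy of it is removed, which lowers
    the rank by one. *)
Lemma pair_gf_recl w l L L' : (0 < l)%N -> (l <= L.+1)%N ->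
  pair_gf w l L.+1 L' =
  pair_gf w l L L' + q ^+ L.+1 * pair_gf (fun m => w (m + 1)) l L.+1 L'.
Proof.
move=> l0 lL; rewrite {1}/pair_gf.
rewrite (@fps_sumID _ _ _ (fun p => head 0%N p.1 != L.+1)); last exact: summable_pair.
congr (_ + _).
  apply: eq_fps_sum => // -[a b] /=; rewrite /pair_in /=; split.
    by case=> /andP[pa pb]; rewrite (part_in_neq pa) => ->.
  move=> /andP[pa pb]; have pa' : part_in l L.+1 a.
    by case/andP: pa => sa /allP aL; rewrite /part_in sa; apply/allP => p /aL; lia.
  by rewrite (part_in_neq pa') pa' pa.
rewrite /pair_gf -fps_sumMl; last exact: summable_pair.
rewrite (@fps_sum_reindex _ _ _ (pair_in l L.+1 L') _ (fun p => (L.+1 :: p.1, p.2))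
  (fun p => (behead p.1, p.2))).
- apply: eq_fps_sum => // p _; rewrite /pair_weight /pair_rank /=.
  rewrite (_ : (size p.1).+1%:Z - (size p.2)%:Z = (size p.1)%:Z - (size p.2)%:Z + 1); last by lia.
  by rewrite exprD -!mulrA mulrCA.
- move=> [a b] /andP[pa pb]; rewrite /pair_in /= part_in_cons pb /= eqxx.
  by rewrite [part_in _ _ _]pa andbT; do !split => //; lia.
move=> [[|x a] b] /= [/andP[pa pb]]; first by [].
rewrite negbK => /eqP xL; rewrite /pair_in /=; split; last by rewrite xL.
by move: pa; rewrite /= part_in_cons xL => /andP[_ ->].
Qed.

Lemma pair_gf_recr w l L L' : (0 < l)%N -> (l <= L'.+1)%N ->
  pair_gf w l L L'.+1 =
  pair_gf w l L L' + q ^+ L'.+1 * pair_gf (fun m => w (m - 1)) l L L'.+1.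
Proof.
move=> l0 lL; rewrite pair_gf_swap pair_gf_recl // pair_gf_swap; congr (_ + _ * _).
  by apply: eq_pair_gf => m; rewrite opprK.
rewrite pair_gf_swap; apply: eq_pair_gf => m.
by rewrite opprD opprK.
Qed.

Lemma pair_gf_empty w l : pair_gf w l.+1 l l = fpsC (w 0).
Proof.
rewrite /pair_gf (@fps_sum_seq _ _ [:: ([::], [::])]) //.
  by rewrite big_seq1 /pair_weight /= /pair_rank /= expr0 !mulr1.
by move=> [a b]; rewrite /pair_in !part_in_empty inE xpair_eqE.
Qed.

Lemma pair_gfZ c w l L L' : (0 < l)%N ->
  pair_gf (fun m => c * w m) l L L' = fpsC c * pair_gf w l L L'.
Proof.
move=> l0; rewrite /pair_gf -fps_sumMl; last exact: summable_pair.
by apply: eq_fps_sum => // p _; rewrite /pair_weight fpsCM !mulrA.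
Qed.

(** For the weight x^m a shift of the rank is multiplication by x or 1/x, so the two recursions
    split off one linear factor of f_(L+1) each. *)
Lemma pair_gf_exp x l L : x \is a GRing.unit -> (0 < l <= L.+1)%N ->
  pair_gf (fun m => x ^ m) l L L =
  \prod_(l <= j < L.+1) (den q (fpsC x) (fpsC x^-1) j)^-1.
Proof.
move=> ux; elim: L => [|L IHL] /andP[l0 lL].
  have -> : l = 1%N by lia.
  by rewrite pair_gf_empty big_geq // expr0z.
have [->|lL'] := eqVneq l L.+2; first by rewrite pair_gf_empty big_geq // expr0z.
have {lL}lL : (l <= L.+1)%N by lia.
rewrite big_nat_recr //= -IHL ?l0 //.
have e1 : pair_gf (fun m => x ^ m) l L.+1 L.+1 * (1 - fpsC x * q ^+ L.+1) =
    pair_gf (fun m => x ^ m) l L L.+1.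
  apply/eqP; rewrite mulrBr mulr1 subr_eq; apply/eqP.
  rewrite {1}pair_gf_recl //; congr (_ + _).
  rewrite (_ : (fun m => _) = (fun m => x * x ^ m)); last first.
    by apply/funext => m; rewrite exprzDr // mulrC.
  by rewrite pair_gfZ //; ring.
have e2 : pair_gf (fun m => x ^ m) l L L.+1 * (1 - fpsC x^-1 * q ^+ L.+1) =
    pair_gf (fun m => x ^ m) l L L.
  apply/eqP; rewrite mulrBr mulr1 subr_eq; apply/eqP.
  rewrite {1}pair_gf_recr //; congr (_ + _).
  rewrite (_ : (fun m => _) = (fun m => x^-1 * x ^ m)); last first.
    by apply/funext => m; rewrite exprzDr // mulrC exprN1.
  by rewrite pair_gfZ //; ring.
by rewrite -e2 -e1 -mulrA /den mulrK // unitrM !unit_1BCqX.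
Qed.

(** The recurrence expresses d m as a combination of values of d multiplied by q^D or q^(2D), so the
    coefficients vanish by induction on the degree, for all m simultaneously. *)
Lemma rank_rec_unique D (d : int -> fps R) : (0 < D)%N ->
  (forall m, d m * (1 + q ^+ (2 * D)) - q ^+ D * (d (m + 1) + d (m - 1)) = 0) ->
  forall m, d m = 0.
Proof.
move=> D0 rec m; apply: eqmP => N; elim/ltn_ind: N m => N IHN m n nN.
have -> : d m = q ^+ D * (d (m + 1) + d (m - 1)) - q ^+ (2 * D) * d m.
  by rewrite -[RHS]addr0 -(rec m); ring.
rewrite -[LHS]/(fps_coef (q ^+ D * (d (m + 1) + d (m - 1))) n - fps_coef (q ^+ (2 * D) * d m) n).
rewrite !coef_qXM.
have IH k i : (i < N)%N -> fps_coef (d k) i = 0.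
  by move=> iN; rewrite (IHN i iN k).
by do 2 case: leqP => ?; rewrite ?subr0 ?sub0r /= ?IH ?addr0 ?subr0 ?oppr0 //; lia.
Qed.

(** This stands in for the partial fraction identity: both sides obey the recurrence of
    [rank_gf_rec], and [rank_rec_unique] annihilates their difference. *)
Lemma pair_gf_rank D m :
  pair_gf (fun n => (n == m)%:R) 1 D D = rank_gf q D m.
Proof.
elim: D m => [|D IHD] m.
  rewrite pair_gf_empty /rank_gf big_geq // addr0 /= eq_sym.
  by case: (m == 0); [|apply: fpsP => -[]].
apply/eqP; rewrite -subr_eq0; apply/eqP; move: m.
apply: (@rank_rec_unique D.+1) => // m.
(* The mixed family [r], with bounds D + 1 and D, is eliminated between [e1] and [e2]; this leaves a
   recurrence for [p] in the three ranks m - 1, m, m + 1. *)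
pose p m := pair_gf (fun n => (n == m)%:R) 1 D.+1 D.+1.
pose r m := pair_gf (fun n => (n == m)%:R) 1 D.+1 D.
have e1 k : p k = r k + q ^+ D.+1 * p (k + 1).
  rewrite [LHS]pair_gf_recr //; congr (_ + _ * _).
  by apply: eq_pair_gf => n; congr (_ %:R); rewrite subr_eq.
have e2 k : r k = rank_gf q D k + q ^+ D.+1 * r (k - 1).
  rewrite -IHD [LHS]pair_gf_recl //; congr (_ + _ * _).
  by apply: eq_pair_gf => n; congr (_ %:R); rewrite eq_sym -subr_eq eq_sym.
have combine (s a b c a' b' c' : fps R) :
    a - s * b = a' * (1 + s * s) - s * (b' + c') + s * (c - s * a) ->
    (a - a') * (1 + s * s) - s * (b - b' + (c - c')) = 0.
  move=> E; transitivity (a - s * b - (a' * (1 + s * s) - s * (b' + c') + s * (c - s * a))).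
    by ring.
  by rewrite E subrr.
have := rank_gf_rec unit_1BqX D m; have := e2 m.
have := e1 m; have := e1 (m - 1); rewrite subrK mul2n -addnn exprD.
move=> h1 h2 h3 h4.
have {}h1 : r (m - 1) = p (m - 1) - q ^+ D.+1 * p m by rewrite h1 addrK.
have {}h2 : r m = p m - q ^+ D.+1 * p (m + 1) by rewrite h2 addrK.
rewrite h1 h2 -h4 in h3.
by apply: combine h3.
Qed.

Definition pos_power x (m : int) : R := if 1 <= m then x ^ m else 0.

(** Pairs are grouped by their rank n. For n >= 1 the exponent i |n| is i n, so every partial
    fraction contributes a geometric series in x q^i. *)
Lemma pair_gf_pos x D : 
  pair_gf (pos_power x) 1 D D =
  \sum_(1 <= i < D.+1) residue q D i *
     (fpsC x * q ^+ i / (1 - fpsC x * q ^+ i) / (1 - q ^+ (2 * i))).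
Proof.
pose A p := pair_in 1 D D p /\ 1 <= pair_rank p.
have sA w : summable A (pair_weight w).
  by apply: sub_summable (summable_pair w D D (ltn0Sn 0)) => p [].
have -> : pair_gf (pos_power x) 1 D D = fps_sum A (pair_weight (fun m => x ^ m)).
  rewrite /pair_gf -(@fps_sum_widen _ _ A).
  - by apply: eq_fps_sum => // p [_ p1]; rewrite /pair_weight /pos_power p1.
  - by move=> p [].
  move=> p pp nA; rewrite /pair_weight /pos_power ifN; last first.
    by apply/negP => p1; apply: nA.
  by apply: fpsP => n; rewrite coef_CM mul0r.
pose t (n : nat) := fpsC (x ^+ n) * rank_gf q D n%:Z.
have -> : fps_sum A (pair_weight (fun m => x ^ m)) =
    fps_sum [set n | (1 <= n)%N]%classic t.
  rewrite (@fps_sum_key _ _ _ _ [set n | (1 <= n)%N]%classic (fun p => `|pair_rank p|%N)) //.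
    apply: eq_fps_sum => // n /= n1; rewrite /t -pair_gf_rank /pair_gf.
    rewrite -fps_sumMl; last exact: summable_pair.
    rewrite -[RHS](@fps_sum_widen _ _ (fun p => A p /\ `|pair_rank p|%N = n)).
    - apply: eq_fps_sum => // p [[_ p1] pn]; rewrite /pair_weight.
      have -> : pair_rank p = n by lia.
      by rewrite eqxx mul1r.
    - by move=> p [[]].
    move=> p pp nA; rewrite /pair_weight.
    have /negPf -> : pair_rank p != n.
      by apply/eqP => pn; apply: nA; split; [split|]; rewrite ?pn; lia.
    by apply: fpsP => j; rewrite !coef_CM mul0r mulr0.
  by move=> p [_ p1] /=; lia.
apply: eqmP => N.
(* Cutting the geometric series after M terms costs a multiple of y^M with y = x q^i, which is
   negligible since i M > N. *)
pose M := N.+1; have NM : (N <= M)%N by rewrite leqnSn.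
have i0 (i n : nat) : (0 < i)%N -> (N < n)%N -> (N < i * n)%N.
  by move=> *; apply: leq_trans (leq_pmull _ _).
apply: eqm_trans (fps_sum_nat NM _) _.
  move=> n Nn; apply: eqmMl0; rewrite /rank_gf.
  have -> : (n%:Z == 0) = false by lia.
  rewrite andbF add0r; apply: eqm_sum0 => i; rewrite mem_index_iota => /andP[i1 _].
  by rewrite mulrAC mulrC; apply: eqm_qXM; apply: i0.
rewrite /t.
under eq_big_nat => n /andP[n1 _].
  rewrite /rank_gf (_ : (n%:Z == 0) = false); last by lia.
  rewrite andbF add0r mulr_sumr.
  over.
rewrite exchange_big /=; apply: eqm_sum => i; rewrite mem_index_iota => /andP[i1 _].
have fpsCX n : fpsC (x ^+ n) = fpsC x ^+ n :> fps R.
  by elim: n => // n IHn; rewrite !exprS fpsCM IHn.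
have u := unit_1BCqX x i1.
set y := fpsC x * q ^+ i in u *.
have -> : \sum_(1 <= n < M.+1) fpsC (x ^+ n) *
    (residue q D i * q ^+ (i * n) / (1 - q ^+ (2 * i))) =
    residue q D i * (y / (1 - y) / (1 - q ^+ (2 * i))) * (1 - y ^+ M).
  transitivity (residue q D i / (1 - q ^+ (2 * i)) * (y * \sum_(0 <= n < M) y ^+ n)).
    rewrite big_add1 /= !mulr_sumr; apply: eq_bigr => n _.
    by rewrite fpsCX exprM -exprS /y exprMn; ring.
  have := subrX1 y M; rewrite -(big_mkord xpredT (fun i => y ^+ i)) => h.
  have {}h : 1 - y ^+ M = (1 - y) * \sum_(0 <= i < M) y ^+ i.
    by rewrite -opprB h -mulNr opprB.
  by rewrite h -[in LHS](mulKr u (\sum_(0 <= n < M) _)); ring.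
rewrite -[X in eqm N _ X]mulr1; apply: eqmMl.
rewrite -[X in eqm N _ X]subr0; apply: eqmD => //; apply: eqmN.
by rewrite /y exprMn -exprM mulrC; apply: eqm_qXM; apply: i0.
Qed.

End PairSums.

(** * Chains of pairs *)

Lemma exchange_triangle (V : nmodType) n (F : nat -> nat -> V) :
  \sum_(1 <= L < n) \sum_(1 <= i < L.+1) F L i =
  \sum_(1 <= i < n) \sum_(i <= L < n) F L i.
Proof.
elim: n => [|[|n] IHn]; [by rewrite !big_geq | by rewrite !big_geq |].
rewrite big_nat_recr //= IHn [RHS]big_nat_recr //= big_nat1.
rewrite [X in _ + X]big_nat_recr //= addrA; congr (_ + _).
rewrite -big_split /=; apply: eq_big_nat => i /andP[_ iN].
by rewrite [RHS]big_nat_recr // ltnW.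
Qed.

(* [(L, (a, b))] stands for the pair of partitions [(L :: a, b)]. *)
Notation layer := (nat * (seq nat * seq nat))%type.

Definition layer_over l (t : layer) : bool :=
  (l <= t.1)%N && pair_in l t.1 t.1 t.2.

(** The first clause supplies the lower end 1 of the interval of the first layer; the second makes
    the top of each layer the lower end of the next interval. *)
Definition chain K (f : {ffun 'I_K.+1 -> layer}) : Prop :=
  (forall j, layer_over 1 (f j)) /\
  (forall i j : 'I_K.+1, j = i.+1 :> nat -> layer_over (f i).1 (f j)).

Definition ffun_rcons K (T : Type) (g : {ffun 'I_K -> T}) (t : T) :
    {ffun 'I_K.+1 -> T} :=
  [ffun j => if unlift ord_max j is Some i then g i else t].

Definition ffun_belast K (T : Type) (f : {ffun 'I_K.+1 -> T}) : {ffun 'I_K -> T} :=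
  [ffun j => f (lift ord_max j)].

Lemma ffun_rcons_max K T (g : {ffun 'I_K -> T}) t : ffun_rcons g t ord_max = t.
Proof. by rewrite ffunE unlift_none. Qed.

Lemma ffun_rcons_lift K T (g : {ffun 'I_K -> T}) t i :
  ffun_rcons g t (lift ord_max i) = g i.
Proof. by rewrite ffunE liftK. Qed.

Lemma ffun_belastK K T (f : {ffun 'I_K.+1 -> T}) :
  ffun_rcons (ffun_belast f) (f ord_max) = f.
Proof.
by apply/ffunP => j; rewrite ffunE; case: unliftP => [i ->|->]; rewrite ?ffunE.
Qed.

Lemma ffun_rconsK K T (g : {ffun 'I_K -> T}) t : ffun_belast (ffun_rcons g t) = g.
Proof. by apply/ffunP => j; rewrite ffunE ffun_rcons_lift. Qed.

Lemma part_in_sub l l' L s : (l' <= l)%N -> part_in l L s -> part_in l' L s.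
Proof.
move=> ll /andP[ss /allP sL]; rewrite /part_in ss /=.
by apply/allP => p /sL; lia.
Qed.

Lemma layer_over_sub l l' t : (l' <= l)%N -> layer_over l t -> layer_over l' t.
Proof.
move=> ll /andP[lt /andP[ta tb]]; rewrite /layer_over /pair_in.
by rewrite (leq_trans ll lt) !(part_in_sub ll).
Qed.

Lemma chain_rcons K (g : {ffun 'I_K.+1 -> layer}) t :
  chain (ffun_rcons g t) <-> chain g /\ layer_over (g ord_max).1 t.
Proof.
split=> [[g1 gS]|[[g1 gS] gt]].
  split; first split=> [j|i j ij].
  - by have := g1 (lift ord_max j); rewrite ffun_rcons_lift.
  - by have := gS (lift ord_max i) (lift ord_max j); rewrite !ffun_rcons_lift !lift_max; apply.
  have := gS (lift ord_max ord_max) ord_max.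
  by rewrite ffun_rcons_lift ffun_rcons_max lift_max; apply.
split=> [j|i j].
  case: (unliftP ord_max j) => [j' ->|->]; rewrite ?ffun_rcons_lift ?ffun_rcons_max //.
  by apply: layer_over_sub gt; have /andP[] := g1 ord_max.
case: (unliftP ord_max j) => [j' ->|->]; case: (unliftP ord_max i) => [i' ->|->];
  rewrite ?ffun_rcons_lift ?ffun_rcons_max ?lift_max /= => ij.
- exact: gS.
- by have := ltn_ord j'; rewrite ij /= ltnS ltnNge leqW.
- by have -> : i' = ord_max by apply: val_inj => /=; lia.
- by lia.
Qed.

Section ChainSums.
Variables (R : comUnitRingType) (w : nat -> int -> R).
Local Notation q := (fpsq : fps R).

(** The top part counts for the size but not for the rank, which accounts for the -1 in the ranks of
    all pairs below the last. *)
Definition layer_weight v (t : layer) : fps R := q ^+ t.1 * pair_weight v t.2.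

Definition chain_weight K (f : {ffun 'I_K.+1 -> layer}) : fps R :=
  \prod_(j < K.+1) layer_weight (w j) (f j).

Lemma chain_weight_rcons K (g : {ffun 'I_K.+1 -> layer}) t :
  chain_weight (ffun_rcons g t) = chain_weight g * layer_weight (w K.+1) t.
Proof.
rewrite /chain_weight big_ord_recr /= ffun_rcons_max; congr (_ * _).
apply: eq_bigr => i _; rewrite -(ffun_rcons_lift g t); congr (layer_weight _ (_ _)).
by apply: val_inj; rewrite /= /bump leqNgt ltn_ord.
Qed.

Definition pos_pair (p : seq nat * seq nat) : bool := (0%N \notin p.1) && (0%N \notin p.2).

Lemma pair_in_pos l L L' p : (0 < l)%N -> pair_in l L L' p -> pos_pair p.
Proof. by rewrite /pos_pair => l0 /andP[/(part_in_pos l0) -> /(part_in_pos l0) ->]. Qed.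

Lemma summable_pos_pair v : summable pos_pair (@pair_weight R v).
Proof.
apply: summableMl.
apply: sub_summable (summable_prod (summable_qXsumn R) (summable_qXsumn R)).
by move=> p /andP[].
Qed.

Lemma summable_qX : summable setT (fun n => q ^+ n).
Proof.
move=> N; exists (iota 0 N.+1) => n _; rewrite mem_iota -leqNgt => Nn.
by rewrite -[q ^+ n]mulr1; apply: eqm_qXM.
Qed.

Lemma summable_layer v : summable (fun t : layer => pos_pair t.2) (layer_weight v).
Proof.
by apply: sub_summable (summable_prod summable_qX (summable_pos_pair v)).
Qed.

(** Induction on K: forgetting the condition between the last two layers embeds the chains into a
    product of two summable families. *)
Lemma summable_chain K : summable (@chain K) (@chain_weight K).
Proof.
elim: K => [|K IHK].
  pose h (f : {ffun 'I_1 -> layer}) := f ord_max.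
  rewrite (_ : @chain_weight 0 = fun f => layer_weight (w 0) (h f)); last first.
    apply/funext => f; rewrite /chain_weight big_ord1 /h; congr (layer_weight _ (f _)).
    exact: val_inj.
  apply: (@summable_reindex _ _ _ _ _ h (fun t => [ffun=> t])) (summable_layer (w 0)).
  move=> f [f1 _]; split; first by have /andP[_ /pair_in_pos -> ] := f1 ord_max.
  by apply/ffunP => j; rewrite ffunE (ord1 j) /h; congr (f _); apply: val_inj.
pose h (f : {ffun 'I_K.+2 -> layer}) := (ffun_belast f, f ord_max).
pose F (p : {ffun 'I_K.+1 -> layer} * layer) := chain_weight p.1 * layer_weight (w K.+1) p.2.
rewrite (_ : @chain_weight K.+1 = fun f => F (h f)); last first.
  by apply/funext => f; rewrite /F -chain_weight_rcons ffun_belastK.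
apply: (@summable_reindex _ _ _ _ _ h (fun p => ffun_rcons p.1 p.2))
  (summable_prod IHK (summable_layer _)).
move=> f cf; split; last exact: ffun_belastK.
have [/chain_rcons[? _]] : chain (ffun_rcons (ffun_belast f) (f ord_max)) /\ True.
  by rewrite ffun_belastK.
by split=> //; case: cf => /(_ ord_max)/andP[_ /pair_in_pos ->].
Qed.

(** The top part is fixed because a further layer depends on the chain below it only through that
    number. *)
Definition chain_gf K D :=
  fps_sum (fun f : {ffun 'I_K.+1 -> layer} => chain f /\ (f ord_max).1 = D)
    (@chain_weight K).

Lemma chain_gf0 D : (0 < D)%N -> chain_gf 0 D = q ^+ D * pair_gf (w 0) 1 D D.
Proof.
move=> D0; rewrite /pair_gf -fps_sumMl; last exact: summable_pair.
apply: etrans (fps_sum_reindex _ (A := pair_in 1 D D)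
  (h := fun p => [ffun=> (D, p)]) (g := fun f => (f ord_max).2) _ _) _.
- move=> p pD; rewrite ffunE; split=> //; split; rewrite ?ffunE //.
  split=> [j|i j]; first by rewrite ffunE /layer_over D0.
  by rewrite (ord1 i) (ord1 j).
- move=> f [[f1 _] fD]; have /andP[_] := f1 ord_max; rewrite fD; split=> //.
  apply/ffunP => j; rewrite ffunE -fD -surjective_pairing (ord1 j).
  by congr (f _); apply: val_inj.
by apply: eq_fps_sum => // p _; rewrite /chain_weight big_ord1 ffunE.
Qed.

(** The last layer is removed and the remaining chains are sorted by their top part L; the removed
    pair ranges freely over parts in [L, D]. *)
Lemma chain_gfS K D : (0 < D)%N ->
  chain_gf K.+1 D =
  q ^+ D * \sum_(1 <= L < D.+1) chain_gf K L * pair_gf (w K.+1) L D D.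
Proof.
move=> D0.
pose B (p : {ffun 'I_K.+1 -> layer} * (seq nat * seq nat)) :=
  chain p.1 /\ layer_over (p.1 ord_max).1 (D, p.2).
pose F (p : {ffun 'I_K.+1 -> layer} * (seq nat * seq nat)) :=
  chain_weight p.1 * pair_weight (w K.+1) p.2.
have pos p : B p -> (0 < (p.1 ord_max).1)%N.
  by case=> -[/(_ ord_max)/andP[]].
have sF : summable B F.
  apply: sub_summable (summable_prod (@summable_chain K) (summable_pos_pair _)).
  move=> p Bp; have := Bp => -[cp /andP[_]].
  by move=> /(pair_in_pos (pos _ Bp)).
have -> : chain_gf K.+1 D = q ^+ D * fps_sum B F.
  rewrite -fps_sumMl //.
  apply: etrans (fps_sum_reindex _ (A := B)
    (h := fun p => ffun_rcons p.1 (D, p.2))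
    (g := fun f => (ffun_belast f, (f ord_max).2)) _ _) _.
  - move=> [g p] Bp; rewrite ffun_rconsK ffun_rcons_max; split=> //; split=> //.
    exact/chain_rcons.
  - move=> f [cf fD]; have e : (D, (f ord_max).2) = f ord_max.
      by rewrite -fD -surjective_pairing.
    split; last by rewrite /= e ffun_belastK.
    by apply/chain_rcons; rewrite e ffun_belastK.
  apply: eq_fps_sum => // -[g p] _; rewrite chain_weight_rcons /F /layer_weight /=.
  by rewrite mulrCA.
congr (_ * _).
have keyD p : B p -> (1 <= (p.1 ord_max).1 <= D)%N.
  by move=> Bp; rewrite pos //=; case: Bp => _ /andP[].
rewrite (fps_sum_key_nat sF keyD).
apply: eq_big_nat => L /andP[L1 LD].
rewrite /chain_gf /pair_gf -fps_sum_prod; last first.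
- exact: summable_pair.
- by apply: sub_summable (@summable_chain K) => f [].
apply: eq_fps_sum => // -[g p]; rewrite /B /layer_over /=; split.
  by move=> [[cg /andP[_ gp]] gL]; rewrite -{2}gL.
by move=> [[cg ->] ->]; rewrite -ltnS LD.
Qed.

End ChainSums.

(** * Closed form of the chain generating functions *)

Section ChainGf.
Variables (R : comUnitRingType) (x : nat -> R).
Hypothesis unit_x : forall j, x j \is a GRing.unit.
Local Notation q := (fpsq : fps R).

(** Nonpositive ranks of the first layer receive weight zero, so sums may run over all chains. *)
Definition rank_weight (j : nat) : int -> R :=
  if j == 0%N then pos_power (x 0) else fun m => x j ^ m.

(** What accompanies [residue D i] after K further layers. It is independent of D, so the final sum
    over D involves the residues only. *)
Definition chain_term K i : fps R :=
  q ^+ (K * i) *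
  (fpsC (x 0) * q ^+ i / (1 - fpsC (x 0) * q ^+ i) / (1 - q ^+ (2 * i))) *
  \prod_(1 <= j < K.+1) (den q (fpsC (x j)) (fpsC (x j)^-1) i)^-1.

(** Induction on K. Once the sums over L and i are exchanged, the inner sum over i <= L <= D is
    [residue_sum_den], and the i-th term gains q^i / f_i(x_j) for the new layer. *)
Lemma chain_gfE K D : (0 < D)%N ->
  chain_gf rank_weight K D =
  q ^+ D * \sum_(1 <= i < D.+1) residue q D i * chain_term K i.
Proof.
elim: K D => [|K IHK] D D0.
  rewrite chain_gf0 // /rank_weight pair_gf_pos; congr (_ * _).
  by apply: eq_bigr => i _; rewrite /chain_term big_geq // expr0 mul1r mulr1.
rewrite chain_gfS //; congr (_ * _).
pose A L := \prod_(L <= j < D.+1) (den q (fpsC (x K.+1)) (fpsC (x K.+1)^-1) j)^-1.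
transitivity (\sum_(1 <= L < D.+1) \sum_(1 <= i < L.+1)
    chain_term K i * (q ^+ L * residue q L i * A L)).
  apply: eq_big_nat => L /andP[L1 LD]; rewrite IHK // pair_gf_exp //; last by lia.
  by rewrite -mulrA mulr_suml mulr_sumr; apply: eq_bigr => i _; rewrite /A; ring.
rewrite exchange_triangle; apply: eq_big_nat => i /andP[i1 iD].
have xx : fpsC (x K.+1) * fpsC (x K.+1)^-1 = 1 by rewrite -fpsCM mulrV.
rewrite -mulr_sumr residue_sum_den //; last by move=> j j0; rewrite unitrM !unit_1BCqX.
- rewrite /chain_term (big_nat_recr K.+1) //= (mulSn K) exprD; ring.
- exact: unit_1BqX.
Qed.

End ChainGf.

(** * Durfee rectangles *)

Section Limit.
Variable R : comUnitRingType.
Local Notation q := (fpsq : fps R).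

Lemma eqm_qXMl N n (f g : fps R) :
  (forall i, (i + n <= N)%N -> fps_coef f i = fps_coef g i) ->
  eqm N (q ^+ n * f) (q ^+ n * g).
Proof.
by move=> fg i iN; rewrite !coef_qXM; case: leqP => // ni; apply: fg; lia.
Qed.

Lemma eqmV N (f g : fps R) : f \is a GRing.unit -> g \is a GRing.unit ->
  eqm N f g -> eqm N f^-1 g^-1.
Proof.
move=> uf ug fg; apply: (@eqm_trans _ N (f^-1 * (g * g^-1))).
  by rewrite mulrV // mulr1.
by rewrite -[X in eqm N _ X](mulKr uf g^-1); apply/eqmMl/eqmM; first exact: eqm_sym.
Qed.

(** The product in question is that of 1 - q^j over M - s < j <= M, hence 1 up to degree M - s. The
    proof obtains this from Pascal's rule. *)
Lemma qbinom_limit M s i : (i + s <= M)%N ->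
  fps_coef (qpoch q s * qbinom q M s) i = (i == 0%N)%:R.
Proof.
elim: M s i => [|M IHM] [|s] i //.
- by rewrite qpoch0 mul1r -(coef_qX R 0).
- by rewrite addnS.
- by rewrite qpoch0 mul1r -(coef_qX R 0).
rewrite addnS ltnS => isM.
have -> : qpoch q s.+1 * qbinom q M.+1 s.+1 = (qpoch q s * qbinom q M s)
   - q ^+ s.+1 * (qpoch q s * qbinom q M s)
   + q ^+ s.+1 * (qpoch q s.+1 * qbinom q M s.+1).
  by rewrite /= qpochS; ring.
rewrite -[LHS]/(fps_coef (qpoch q s * qbinom q M s) i
  - fps_coef (q ^+ s.+1 * (qpoch q s * qbinom q M s)) i
  + fps_coef (q ^+ s.+1 * (qpoch q s.+1 * qbinom q M s.+1)) i).
rewrite !coef_qXM IHM //; case: leqP => si; first by rewrite subr0 addr0.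
by rewrite !IHM ?subrK //; lia.
Qed.

Lemma qqinf_unit : (qqinf : fps R) \is a GRing.unit.
Proof.
by apply: fps_unit1; rewrite -(fps_coef_qqinf (leqnn 0)) big_geq.
Qed.

Lemma eqm_qpochV N M : (N <= M)%N -> eqm N (qpoch q M)^-1 qqinf^-1.
Proof.
move=> NM; apply: eqmV; [exact/qpoch_unit/unit_1BqX | exact: qqinf_unit |].
by move=> i iN; apply: fps_coef_qqinf; apply: leq_trans NM.
Qed.

(** With D = s + i and m = 2 i one has D^2 = i^2 + s (s + m). This is [durfee_rectangle] for large
    M, where the Gaussian binomial approaches 1/(q;q)_s. *)
Lemma durfee_rectangle_limit N i : (0 < i)%N -> (i <= N)%N ->
  eqm N (\sum_(i <= D < N.+1)
      q ^+ (D ^ 2) * ((qpoch q (D + i))^-1 * (qpoch q (D - i))^-1))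
    (q ^+ (i ^ 2) / qqinf).
Proof.
move=> i0 iN; pose m := (2 * i)%N.
pose t s := q ^+ (i ^ 2) * (q ^+ (s * (s + m)) *
  ((qpoch q s)^-1 * (qpoch q (s + m))^-1)).
apply: (@eqm_trans _ N (\sum_(0 <= s < N.+1) t s)); last first.
  rewrite /t -mulr_sumr; apply: eqmMl.
  apply: eqm_trans (eqm_qpochV (leq_addr m N)).
  rewrite -(durfee_rectangle (@unit_1BqX R)); apply: eqm_sum => s.
  rewrite mem_index_iota /= ltnS => sN.
  rewrite mulrA; apply: eqmM; last by [].
  (* The prefactor q^(s(s+m)) has exponent at least s, so only degrees up to N - s matter, and there
     [qbinom_limit] applies. *)
  apply: eqm_qXMl => j jN.
  have us := qpoch_unit (@unit_1BqX R) s.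
  rewrite -[qbinom q N s](mulKr us) -[X in fps_coef X j = _]mulr1.
  apply: (@eqmMl _ j) => // n nj; rewrite qbinom_limit -?(coef_qX R 0) //.
  have : (s <= s * (s + m))%N by apply: leq_pmulr; rewrite /m; lia.
  by lia.
(* The sum over D ends at s = N - i. Beyond it s (s + m) >= s + 2 i > N, so those terms vanish
   modulo q^(N+1). *)
rewrite [X in eqm N _ X](big_cat_nat (n := (N.+1 - i)%N)) //=; last by lia.
rewrite -[X in eqm N X _]addr0; apply: eqmD; last first.
  apply/eqm_sym/eqm_sum0 => s; rewrite mem_index_iota => /andP[s1 s2].
  apply/eqmMl0/eqm_qXM; case: s s1 s2 => [|s] s1 s2; first by lia.
  by apply: leq_trans (leq_pmull _ _) => //; rewrite /m; lia.
rewrite -{1}[i]add0n big_addn; apply: eqm_sum => s _; rewrite /t.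
rewrite addnK -addnA addnn -mul2n mulrA -exprD [(qpoch q s)^-1 * _]mulrC.
by have -> : ((s + i) ^ 2 = i ^ 2 + s * (s + m))%N by rewrite /m; lia.
Qed.

End Limit.

(** * Marked Durfee symbols as chains *)

(** Translates intervals of parts into the conditions on marked symbols. The implication guards
    against the default value 0 of [smallest] on the empty list. *)
Lemma part_inE l L s : (0 < l)%N -> part_in l L s =
  [&& is_partition s, largest s <= L & (s != [::]) ==> (l <= Defs.smallest s)]%N.
Proof.
move=> l0; elim: s L => [|x s IHs] L //; rewrite part_in_cons IHs.
rewrite /is_partition /largest /Defs.smallest /= inE negb_or.
case: s {IHs} => [|y s] /=; first by lia.
rewrite !inE !negb_or; set P := path _ _ _; set Z := 0%N \notin s.
have : P -> (last y s <= y)%N.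
  rewrite /P => {P}; elim: s y {Z} => //= z s IHs y /andP[zy /IHs]; lia.
move: P Z; case; case => //= H; rewrite ?andbF ?andbT //.
have {}H := H isT. lia.
Qed.

Lemma smallest_partition_gt0 s : is_partition s -> s != [::] -> (0 < Defs.smallest s)%N.
Proof.
case: s => // x s /andP[_ s0] _; rewrite lt0n; apply: contraNneq s0 => <-.
exact: mem_last.
Qed.

Section Arrays.
Variable K : nat.
Implicit Types (f : {ffun 'I_K.+1 -> layer}) (tau : durfee_array K.+1).

Definition array_of_chain f : durfee_array K.+1 :=
  DurfeeArray
    [ffun j : 'I_K.+1 => if (j.+1 < K.+1)%N then (f j).1 :: (f j).2.1 else (f j).2.1]
    [ffun j => (f j).2.2] (f ord_max).1.

Definition chain_of_array tau : {ffun 'I_K.+1 -> layer} :=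
  [ffun j : 'I_K.+1 => if (j.+1 < K.+1)%N
    then (largest (alpha tau j), (behead (alpha tau j), beta tau j))
    else (side tau, (alpha tau j, beta tau j))].

Definition array_size tau : nat :=
  (\sum_j (sumn (alpha tau j) + sumn (beta tau j)) + side tau ^ 2)%N.

Lemma marked_durfee_size n tau : marked_durfee n tau -> n = array_size tau.
Proof. by case: tau => a b D []. Qed.

Lemma ord_lastP (j : 'I_K.+1) : ~~ (j.+1 < K.+1)%N -> j = ord_max.
Proof. by move=> jK; apply: val_inj; have := ltn_ord j; rewrite /=; lia. Qed.

Lemma chain_le_max f j : chain f -> ((f j).1 <= (f ord_max).1)%N.
Proof.
move=> [_ fS]; have [d] : exists d, (K - j = d)%N by exists (K - j)%N.
elim: d j => [|d IHd] j jd.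
  by rewrite (@ord_lastP j) //; lia.
have jK : (j.+1 < K.+1)%N by lia.
have /andP[le_j _] := fS j (Ordinal jK) (erefl _).
by apply: leq_trans le_j _; apply: IHd => /=; lia.
Qed.

Lemma array_of_chain_valid f : chain f ->
  marked_durfee (array_size (array_of_chain f)) (array_of_chain f).
Proof.
move=> cf; have [f1 fS] := cf.
have alphaP l j : layer_over l (f j) ->
    part_in l (f j).1 (alpha (array_of_chain f) j).
  move=> /and3P[lf fa _]; rewrite ffunE; case: ifP => // _.
  by rewrite part_in_cons lf leqnn.
have alpha1 j : part_in 1 (f j).1 (alpha (array_of_chain f) j) by apply: alphaP.
have beta1 j : part_in 1 (f j).1 (beta (array_of_chain f) j).
  by rewrite ffunE; have /and3P[] := f1 j.
split=> //.
- split; first by have /andP[] := f1 ord_max.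
  move=> j; have := alpha1 j; have := beta1 j; rewrite !part_inE //.
  by move=> /and3P[? _ _] /and3P[].
- by move=> j jK; rewrite ffunE jK.
- move=> i j ij; have iK : (i.+1 < K.+1)%N by rewrite -ij ltn_ord.
  have Li : largest (alpha (array_of_chain f) i) = (f i).1 by rewrite ffunE iK.
  have li0 : (0 < (f i).1)%N by have /andP[] := f1 i.
  rewrite -!/(alpha (array_of_chain f) _) -!/(beta (array_of_chain f) _) Li; split.
  + by have := beta1 i; rewrite part_inE // => /and3P[].
  + have := alphaP _ _ (fS i j ij).
    by rewrite part_inE // => /and3P[_ _ /implyP].
  have : part_in (f i).1 (f j).1 (beta (array_of_chain f) j).
    by rewrite ffunE; have /and3P[] := fS i j ij.
  by rewrite part_inE // => /and3P[_ _ /implyP].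
move=> j; have := alpha1 j; have := beta1 j; rewrite !part_inE //.
move=> /and3P[_ bj _] /and3P[_ aj _].
by split; apply: leq_trans (chain_le_max j cf).
Qed.

Lemma chain_of_array_chain n tau : marked_durfee n tau -> chain (chain_of_array tau).
Proof.
case: tau => a b D [[D0 part] a_ne ord le_D _].
pose L j := (chain_of_array (DurfeeArray a b D) j).1.
have Llt (j : 'I_K.+1) : (j.+1 < K.+1)%N -> L j = largest (a j).
  by move=> jK; rewrite /L ffunE jK.
(* Below the last pair, the head of [a j] is the upper end [L j] and is stripped off. The last pair
   stays intact, and there l <= D gives the bound on the top part. *)
have over l j : (0 < l)%N -> (l <= D)%N ->
   part_in l (L j) (a j) -> part_in l (L j) (b j) ->
   layer_over l (chain_of_array (DurfeeArray a b D) j).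
  move=> l0 lD; rewrite /L /layer_over /pair_in ffunE; case: ifP => jK /= pa pb.
    have := a_ne _ jK; move: pa pb; case: (a j) => // x s.
    by rewrite /= part_in_cons /= => /andP[/andP[-> _] ->] ->.
  by rewrite lD pa pb.
have largest_b j : (largest (b j) <= L j)%N.
  have [jK|jK] := boolP (j.+1 < K.+1)%N; last by rewrite /L ffunE ifN // (le_D j).2.
  by rewrite Llt //; have [] := ord j (Ordinal jK) (erefl _).
have largest_a j : (largest (a j) <= L j)%N.
  have [jK|jK] := boolP (j.+1 < K.+1)%N; first by rewrite Llt.
  by rewrite /L ffunE ifN // (le_D j).1.
split=> [j|i j ij].
  have [pa pb] := part j.
  apply: over; rewrite // part_inE // ?pa ?pb ?largest_a ?largest_b /=;
    by apply/implyP; apply: smallest_partition_gt0.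
have iK : (i.+1 < K.+1)%N by rewrite -ij ltn_ord.
rewrite -/(L i) Llt //.
have [pa pb] := part j; have [_ ha hb] := ord i j ij.
have li : (0 < largest (a i))%N.
  have := a_ne i iK; have [/andP[_]] := part i.
  by rewrite /largest; case: (a i) => //= x s; rewrite inE negb_or eq_sym lt0n => /andP[].
apply: over => //; first exact: (le_D i).1.
  by rewrite part_inE // pa largest_a; apply/implyP.
by rewrite part_inE // pb largest_b; apply/implyP.
Qed.

Lemma array_of_chainK : cancel array_of_chain chain_of_array.
Proof.
move=> f; apply/ffunP => j; rewrite ffunE /= !ffunE.
have [jK|/ord_lastP ->] := boolP (j.+1 < K.+1)%N.
  by case: (f j) => ? [].
by case: (f ord_max) => ? [].
Qed.

(** Nonemptiness of alpha^j below the last pair lets its head and tail be reassembled. *)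
Lemma chain_of_arrayK n tau : marked_durfee n tau ->
  array_of_chain (chain_of_array tau) = tau.
Proof.
case: tau => a b D [_ a_ne _ _ _]; congr DurfeeArray.
- apply/ffunP => j; rewrite !ffunE; have := a_ne j.
  by have [jK /(_ isT)|] := boolP (j.+1 < K.+1)%N => //=; case: (a j).
- by apply/ffunP => j; rewrite !ffunE /=; case: ifP.
- by rewrite ffunE ltnn.
Qed.

Lemma durfee_rank_chain f j : durfee_rank (array_of_chain f) j = pair_rank (f j).2.
Proof. by rewrite /durfee_rank /pair_rank /= !ffunE; case: ifP => _ /=; lia. Qed.

(** One D is taken out of D^2 as the top part of the last layer, which makes all layers alike; D (D
    - 1) remains outside. *)
Lemma array_size_chain f :
  (array_size (array_of_chain f) = (f ord_max).1 * (f ord_max).1.-1 +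
   \sum_j ((f j).1 + (sumn (f j).2.1 + sumn (f j).2.2)))%N.
Proof.
rewrite /array_size /= !big_ord_recr /= !ffunE ltnn.
under eq_bigr => j _ do rewrite !ffunE /= ltnS ltn_ord /= -addnA.
by case: ((f ord_max).1) => [|d] /=; lia.
Qed.

(** * From sums over symbols to sums over chains *)

Variables (R : comUnitRingType) (x : nat -> R).
Hypothesis unit_x : forall j, x j \is a GRing.unit.
Local Notation q := (fpsq : fps R).

Definition array_weight tau : fps R :=
  fpsC (\prod_(j < K.+1) x j ^ durfee_rank tau j) * q ^+ array_size tau.

Definition positive_array tau : Prop :=
  (exists n, marked_durfee n tau) /\ 1 <= durfee_rank tau ord0.

Definition marked_weight f : fps R :=
  q ^+ ((f ord_max).1 * (f ord_max).1.-1) * chain_weight (rank_weight x) f.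

Lemma array_weight_chain f : 1 <= pair_rank (f ord0).2 ->
  array_weight (array_of_chain f) = marked_weight f.
Proof.
move=> f0; rewrite /array_weight array_size_chain exprD mulrCA; congr (_ * _).
rewrite -prodrXr fpsC_prod -big_split; apply: eq_bigr => j _ /=.
rewrite durfee_rank_chain /layer_weight /pair_weight !exprD mulrCA; congr (_ * (fpsC _ * _)).
rewrite /rank_weight /pos_power; case: (eqVneq (j : nat) 0%N) => // j0.
by have -> : j = ord0 by [apply: val_inj]; rewrite f0.
Qed.

Lemma marked_weight0 f : ~~ (1 <= pair_rank (f ord0).2) -> marked_weight f = 0.
Proof.
move=> /negPf f0; rewrite /marked_weight /chain_weight big_ord_recl /layer_weight.
rewrite /rank_weight /pair_weight /pos_power /= f0.
have -> : fpsC 0 = 0 :> fps R by apply: fpsP => -[].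
by rewrite !(mul0r, mulr0).
Qed.

Lemma summable_marked : summable (@chain K) marked_weight.
Proof. exact/summableMl/summable_chain. Qed.

Lemma positive_array_chain tau : positive_array tau ->
  (chain (chain_of_array tau) /\ 1 <= pair_rank (chain_of_array tau ord0).2) /\
  array_of_chain (chain_of_array tau) = tau.
Proof.
move=> [[n tau_n] r0]; have tauK := chain_of_arrayK tau_n; split=> //.
by rewrite -durfee_rank_chain tauK; split=> //; apply: chain_of_array_chain tau_n.
Qed.

Lemma summable_array : summable positive_array array_weight.
Proof.
move=> N; have [r rF] := summable_marked N.
exists (map array_of_chain r) => tau /positive_array_chain[[ctau r0] <-] tau_r.
rewrite array_weight_chain //; apply: rF => //.
by apply: contra tau_r => tau_r; apply: map_f.
Qed.

(** The bijection matches symbols and chains of positive first rank; all other chains have weight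
    zero. *)
Lemma fps_sum_arrays :
  fps_sum positive_array array_weight = fps_sum (@chain K) marked_weight.
Proof.
rewrite -(@fps_sum_widen _ _ (fun f => chain f /\ 1 <= pair_rank (f ord0).2)); last first.
- move=> f cf nf; apply: marked_weight0; apply/negP => f0; exact: nf.
- by move=> f [].
apply: etrans (fps_sum_reindex _ (A := fun f => chain f /\ 1 <= pair_rank (f ord0).2)
  (h := array_of_chain) (g := chain_of_array) _ _) _.
- move=> f [cf f0]; rewrite array_of_chainK; split=> //.
  split; last by rewrite durfee_rank_chain.
  by exists (array_size (array_of_chain f)); apply: array_of_chain_valid.
- by move=> tau /positive_array_chain[].
by apply: eq_fps_sum => // f [_ f0]; apply: array_weight_chain.
Qed.

(** Symbols are grouped by their vector of ranks; within one group all carry the same monomial, so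
    the coefficient of q^N is a count. *)
Lemma fps_sum_ranks :
  fps_sum [set m : {ffun 'I_K.+1 -> int} | 1 <= m ord0]%classic (fun m =>
    fps_sum [set n : nat | (1 <= n)%N]%classic (fun n =>
      (durfee_count m n)%:R * fpsC (\prod_(j < K.+1) x j ^ m j) * q ^+ n)) =
  fps_sum positive_array array_weight.
Proof.
rewrite (@fps_sum_key _ _ _ _
  [set m : {ffun 'I_K.+1 -> int} | 1 <= m ord0]%classic
  (fun tau => [ffun j => durfee_rank tau j]) _ summable_array); last first.
  by move=> tau [_] /=; rewrite ffunE.
apply: eq_fps_sum => // m /= m0; apply: fpsP => N.
set y := \prod_(j < _) _.
have coefMn (f : fps R) c : fps_coef (f *+ c) N = fps_coef f N *+ c.
  by elim: c => // c IHc; rewrite !mulrSr -IHc.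
(* The sum over n starts at 1, whereas N may be 0; since D > 0, no symbol has size 0. *)
have countN : (N == 0)%N -> durfee_count m N = 0%N.
  move=> /eqP ->; apply/eqP; rewrite /durfee_count cardfs_eq0; apply/eqP/fsetP => tau.
  rewrite in_fset_set; last exact: durfee_set_finite.
  rewrite inE; apply/negP; rewrite inE => -[].
  case: tau => a b D [[D0 _] _ _ _ /eqP]; rewrite addn_eq0 expn_eq0; lia.
transitivity (y *+ durfee_count m N).
  rewrite (fps_sum_nat (leqnn N)) //; last first.
    by move=> n Nn; rewrite mulrC; apply: eqm_qXM.
  rewrite fps_coef_sum.
  have coefE n : fps_coef ((durfee_count m n)%:R * fpsC y * q ^+ n) N =
      if N == n then y *+ durfee_count m n else 0.
    rewrite mulr_natl mulrnAl coefMn coef_CM coef_qX.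
    by case: eqP; rewrite ?mulr1 // mulr0 mul0rn.
  under eq_bigr do rewrite coefE.
  have [N0|N0] := posnP N.
    by rewrite countN ?N0 // big_geq.
  rewrite (big_nat_recr N) //= eqxx big_nat_cond big1 ?add0r // => n.
  by move=> /andP[/andP[_ nN] _]; rewrite gtn_eqF.
rewrite coef_fps_sum (fsbigE (enum_fset (fset_set (durfee_set m N)))) ?fset_uniq //; last first.
- move=> tau [[[n tau_n] r0] rk]; rewrite in_fset_set; last exact: durfee_set_finite.
  move=> tauN; rewrite /array_weight coef_CM coef_qX; case: eqP; last by rewrite mulr0.
  move=> Ns; case/negP: tauN; rewrite inE; split.
    by rewrite Ns -(marked_durfee_size tau_n).
  by move=> j; rewrite -rk ffunE.
- move=> tau; rewrite /= in_fset_set; last exact: durfee_set_finite.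
  rewrite inE => -[tau_N rk]; split; last by apply/ffunP => j; rewrite ffunE.
  by split; [exists N | rewrite rk].
rewrite big_seq_cond (eq_bigr (fun _ => y)); last first.
  move=> tau /andP[]; rewrite in_fset_set; last exact: durfee_set_finite.
  rewrite inE => -[tau_N rk] _; rewrite /array_weight coef_CM coef_qX.
  rewrite -(marked_durfee_size tau_N) eqxx mulr1.
  by apply: eq_bigr => j _; rewrite rk.
rewrite (eq_bigl (fun tau => tau \in enum_fset (fset_set (durfee_set m N)))); last first.
  move=> tau; apply: andb_idr; rewrite in_fset_set; last exact: durfee_set_finite.
  rewrite !inE => -[tau_N rk]; split; last by apply/ffunP => j; rewrite ffunE.
  by split; [exists N | rewrite rk].
by rewrite -big_seq big_const_seq count_predT iter_addr_0.
Qed.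

Lemma fps_sum_marked :
  fps_sum (@chain K) marked_weight =
  fps_sum [set D | (1 <= D)%N]%classic (fun D =>
    q ^+ (D * D.-1) * chain_gf (rank_weight x) K D).
Proof.
rewrite (@fps_sum_key _ _ _ _ [set D | (1 <= D)%N]%classic
  (fun f => (f ord_max).1) _ summable_marked); last first.
  by move=> f [/(_ ord_max)/andP[]].
apply: eq_fps_sum => // D _; rewrite /chain_gf -fps_sumMl.
  by apply: eq_fps_sum => // f [_ <-].
by apply: sub_summable (@summable_chain _ _ _) => f [].
Qed.

(** Modulo q^(N+1) both sums stop at N. Exchanging D and i leaves, for each i, the sum over D of
    [durfee_rectangle_limit]. In the exponent, C(n,2) comes from the residue and n^2 from the
    rectangle. *)
Lemma fps_sum_marked_closed :
  fps_sum (@chain K) marked_weight =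
  qqinf^-1 * fps_sum [set n | (1 <= n)%N]%classic (fun n =>
    (-1) ^+ n.+1 * q ^+ ('C(n, 2) + n ^ 2) * (1 - q ^+ n) * (1 - q ^+ (2 * n))
    * chain_term x K n).
Proof.
rewrite fps_sum_marked; apply: eqmP => N.
set T := fun n => (-1) ^+ n.+1 * _ * _ * _ * _.
have sq D : (D * D.-1 + D = D ^ 2)%N by case: D => //= D; lia.
have sqN n : (N < n)%N -> (N < n ^ 2)%N.
  by move=> Nn; rewrite (leq_trans Nn) // -mulnn leq_pmulr // (leq_trans _ Nn).
have gfD D : (0 < D)%N -> q ^+ (D * D.-1) * chain_gf (rank_weight x) K D =
    q ^+ (D ^ 2) * \sum_(1 <= i < D.+1) residue q D i * chain_term x K i.
  by move=> D0; rewrite chain_gfE // mulrA -exprD sq.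
apply: eqm_trans (fps_sum_nat (leqnn N) _) _.
  by move=> D ND; rewrite gfD; [apply/eqm_qXM/sqN | lia].
apply: eqm_trans (eqm_sym (eqmMl _ (fps_sum_nat (leqnn N) _))); last first.
  move=> n Nn; rewrite /T -!mulrA [_ ^+ _ * (q ^+ _ * _)]mulrCA exprD -mulrA mulrCA.
  by apply/eqm_qXM/sqN.
pose S D i := (-1) ^+ i.+1 * q ^+ 'C(i, 2) * (1 - q ^+ i) * (1 - q ^+ (2 * i))
  * chain_term x K i * (q ^+ (D ^ 2) * ((qpoch q (D + i))^-1 * (qpoch q (D - i))^-1)).
rewrite (_ : \sum_(1 <= D < N.+1) _ = \sum_(1 <= D < N.+1) \sum_(1 <= i < D.+1) S D i); last first.
  apply: eq_big_nat => D /andP[D0 _]; rewrite gfD // mulr_sumr.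
  by apply: eq_bigr => i _; rewrite /S /residue; ring.
rewrite exchange_triangle mulr_sumr; apply: eqm_sum => i.
rewrite mem_index_iota ltnS => /andP[i0 iN].
rewrite /S -mulr_sumr; apply: eqm_trans (eqmMl _ (durfee_rectangle_limit _ i0 iN)) _.
rewrite /T exprD; set A := qqinf^-1; set H := chain_term x K i.
rewrite (_ : _ * (_ * A) = A * ((-1) ^+ i.+1 * (q ^+ 'C(i, 2) * q ^+ (i ^ 2))
  * (1 - q ^+ i) * (1 - q ^+ (2 * i)) * H)) //.
by ring.
Qed.

End Arrays.

(** * Final form of the summands and Laurent variables *)

Lemma lvar_unit n (i : 'I_n) : lvar i \is a GRing.unit.
Proof.
rewrite unitfE /lvar tofrac_eq0; apply/eqP => /(congr1 (mcoeff U_(i)%MM)).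
by rewrite mcoeffX eqxx mcoeff0.
Qed.

(** The factor 1 - q^(2n) of the residue cancels the one from the expansion of 1/f_n, and the q^n of
    the geometric series completes C(n,2) + n^2 to n (3n+1)/2. *)
Lemma chain_term_closed (R : comUnitRingType) (x : nat -> R) K n :
  (forall j, x j \is a GRing.unit) -> (0 < n)%N ->
  (-1) ^+ n.+1 * fpsq ^+ ('C(n, 2) + n ^ 2) * (1 - fpsq ^+ n) * (1 - fpsq ^+ (2 * n))
    * chain_term x K n =
  (-1) ^+ (n - 1) * fpsq ^+ ((n * (3 * n + 1)) %/ 2 + K * n)
  * (fpsC (x 0) * (1 - fpsq ^+ n)
     / ((1 - fpsC (x 0) * fpsq ^+ n) * \prod_(1 <= j < K.+1)
         ((1 - fpsC (x j) * fpsq ^+ n) * (1 - fpsC (x j)^-1 * fpsq ^+ n)))).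
Proof.
move=> ux n0; rewrite /chain_term.
set P := \prod_(1 <= j < K.+1) (_ * _).
have uP : P \is a GRing.unit.
  rewrite /P; elim/big_ind: _ => [|a b ua ub|j _]; rewrite ?unitr1 // unitrM ?ua //.
  by rewrite !unit_1BCqX.
have -> : \prod_(1 <= j < K.+1) (den fpsq (fpsC (x j)) (fpsC (x j)^-1) n)^-1 = P^-1.
  by rewrite -prodrV // => j _; rewrite unitrM !unit_1BCqX.
have u1 := unit_1BCqX (x 0) n0.
rewrite (invrM u1 uP).
have -> : (-1) ^+ n.+1 = (-1) ^+ (n - 1) :> fps R.
  by case: n n0 {uP P u1} => // n _; rewrite subn1 /= !exprS mulrA mulrNN !mul1r.
have -> : (n * (3 * n + 1) %/ 2 = 'C(n, 2) + n ^ 2 + n)%N.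
  have := mul_bin_diag n 1; rewrite bin1.
  by case: n n0 {uP P u1} => //= n _; lia.
have u2 : (1 - fpsq ^+ (2 * n) : fps R) \is a GRing.unit.
  by apply: unit_1BqX; lia.
move: u2; set X := 1 - fpsq ^+ (2 * n) => u2; rewrite !exprD.
rewrite -[RHS]mulr1 -[Y in _ = _ * Y](mulrV u2).
by ring.
Qed.

(** The variables enter the argument only through their invertibility, so the identity is proved for
    arbitrary units and then specialised to the Laurent variables. *)
Theorem rank_gf_positive_first (R : comUnitRingType) k (z : 'I_k.+1 -> R) :
  (forall j, z j \is a GRing.unit) ->
  let q : fps R := fpsq in
  let x (j : 'I_k.+1) := fpsC (z j) in
  let x_inv (j : 'I_k.+1) := fpsC ((z j)^-1) in
  \fpsum_(m in [set m : {ffun 'I_k.+1 -> int} | 1 <= m ord0]%classic)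
    \fpsum_(n in [set n : nat | (1 <= n)%N]%classic)
      (durfee_count m n)%:R * fpsC (\prod_(j < k.+1) z j ^ m j) * q ^+ n
  = qqinf^-1 *
    \fpsum_(n in [set n : nat | (1 <= n)%N]%classic)
      (-1) ^+ (n - 1) * q ^+ ((n * (3 * n + 1)) %/ 2 + k * n)
      * (x ord0 * (1 - q ^+ n)
         / ((1 - x ord0 * q ^+ n)
            * \prod_(j < k.+1 | j != ord0)
                ((1 - x j * q ^+ n) * (1 - x_inv j * q ^+ n)))).
Proof.
move=> uz q x x_inv.
(* The chain lemmas index variables by natural numbers; [y] extends [z], and both sides involve its
   values at j <= k only. *)
pose y n := z (inord n).
have yE (j : 'I_k.+1) : y j = z j by rewrite /y inord_val.
have uy n : y n \is a GRing.unit by apply: uz.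
have lhs := fps_sum_ranks k y.
rewrite fps_sum_arrays fps_sum_marked_closed // in lhs.
transitivity (\fpsum_(m in [set m : {ffun 'I_k.+1 -> int} | 1 <= m ord0]%classic)
    \fpsum_(n in [set n : nat | (1 <= n)%N]%classic)
      ((durfee_count m n)%:R * fpsC (\prod_(j < k.+1) y j ^ m j) * q ^+ n)).
  apply: eq_fps_sum => // m _; apply: eq_fps_sum => // n _.
  by congr (_ * fpsC _ * _); apply: eq_bigr => j _; rewrite yE.
rewrite lhs; congr (_ * _); apply: eq_fps_sum => // n n0.
rewrite chain_term_closed //.
have -> : y 0%N = z ord0 := yE ord0.
congr (_ * (_ / (_ * _))).
rewrite big_mkcond [RHS]big_mkcond big_ord_recl /= mul1r big_add1 big_mkord.
apply: eq_bigr => j _.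
by have -> : y j.+1 = z (lift ord0 j) := yE (lift ord0 j).
Qed.

Theorem theorem3p3 (k : nat) (hk : (1 <= k)%N) :
  let q : fps (laurent_frac k.+1) := fpsq in
  let x (j : 'I_k.+1) := fpsC (lvar j) in
  let x_inv (j : 'I_k.+1) := fpsC ((lvar j)^-1) in
  \fpsum_(m in [set m : {ffun 'I_k.+1 -> int} | 1 <= m ord0]%classic)
    \fpsum_(n in [set n : nat | (1 <= n)%N]%classic)
      (durfee_count m n)%:R * fpsC (\prod_(j < k.+1) lvar j ^ m j) * q ^+ n
  = qqinf^-1 *
    \fpsum_(n in [set n : nat | (1 <= n)%N]%classic)
      (-1) ^+ (n - 1) * q ^+ ((n * (3 * n + 1)) %/ 2 + k * n)
      * (x ord0 * (1 - q ^+ n)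
         / ((1 - x ord0 * q ^+ n)
            * \prod_(j < k.+1 | j != ord0)
                ((1 - x j * q ^+ n) * (1 - x_inv j * q ^+ n)))).
Proof. exact: rank_gf_positive_first (@lvar_unit k.+1). Qed.
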